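(* For each $r\in\mathbb{N}$, the DP-core $\mathrm{VC}_r$ is $\mathcal{I}$-coherent. Additionally, for each $k\in\mathbb{N}$, $P(\mathrm{VC}_r[k],\mathcal{I})$ equals the set of graphs of treewidth at most $k$ that have a vertex cover of size at most $r$.
   Context: A graph is $G=(V,E,I)$ with $V,E$ finite subsets of $\mathbb{N}$, $I\subseteq E\times V$ (multi-edges allowed); $\simeq$ isomorphism; isomorphism closure = all graphs isomorphic to a member. A vertex cover is a vertex set meeting every edge. Instructive tree decompositions: $\Sigma_k$ consists of $\mathrm{Leaf}$ (arity 0), $\mathrm{IntroVertex}_u$, $\mathrm{ForgetVertex}_u$, $\mathrm{IntroEdge}_{u,v}$ (arity 1), $\mathrm{Join}$ (arity 2), $u\ne v\in[k+1]$. $L_k$ is the set of terms accepted by the tree automaton with states all $B\subseteq[k+1]$ (all final), transitions $\mathrm{Leaf}\to\emptyset$; $\mathrm{IntroVertex}_u(B)\to B\cup\{u\}$ ($u\notin B$); $\mathrm{ForgetVertex}_u(B)\to B\setminus\{u\}$ ($u\in B$); $\mathrm{IntroEdge}_{u,v}(B)\to B$ ($u,v\in B$); $\mathrm{Join}(B,B)\to B$. Graph $G(\tau)$ and injective map $\iota_\tau$ from active labels to vertices: $\mathrm{Leaf}$: empty graph; $\mathrm{IntroVertex}_u$: add new vertex labelled $u$; $\mathrm{ForgetVertex}_u$: unlabel it; $\mathrm{IntroEdge}_{u,v}$: add a new edge between the vertices labelled $u,v$; $\mathrm{Join}(\sigma_1,\sigma_2)$: glue disjoint copies of $G(\sigma_1),G(\sigma_2)$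 identifying equally-labelled active vertices. The instructive tree decomposition class is $\mathcal{I}=\{(\Sigma_k,L_k,G|_{L_k})\}_k$. DP-cores: $C[k]=(\Sigma_k,W_k,F_k,T_k,\mathrm{Clean}_k,\mathrm{Inv}_k)$ with set extensions $\hat a(S_1,\dots,S_p)=\mathrm{Clean}_k(\bigcup_{w_i\in S_i}\hat a(w_1,\dots,w_p))$, $\mathrm{Dyn}_k(\mathrm{Leaf})=\widehat{\mathrm{Leaf}}$, $\mathrm{Dyn}_k(a(\tau_1,\dots))=\hat a(\mathrm{Dyn}_k(\tau_1),\dots)$; $\tau$ accepted by $C[k]$ iff $\mathrm{Dyn}_k(\tau)$ contains a final witness. $P(C[k],\mathcal{I})$ = isomorphism closure of $\{G(\tau):\tau\in L_k$ accepted by $C[k]\}$. $C$ is $\mathcal{I}$-coherent if for all $\tau\in L_k,\tau'\in L_{k'}$ with $G(\tau)\simeq G(\tau')$: $\tau$ accepted by $C[k]$ iff $\tau'$ accepted by $C[k']$, and $\mathrm{Inv}_k(\mathrm{Dyn}_k(\tau))=\mathrm{Inv}_{k'}(\mathrm{Dyn}_{k'}(\tau'))$. $\mathrm{VC}_r[k]$: witnesses $(R,s)$, $R\subseteq[k+1]$, $s\in\{0,\dots,r\}$, all final; $\mathrm{Clean}(S)$ keeps $(R,s)\in S$ only if no $(R,s')\in S$ with $s'<s$; $\mathrm{Inv}(S)=\min\{s:(R,s)\in S\}$; $\widehat{\mathrm{Leaf}}=\{(\emptyset,0)\}$; $\widehat{\mathrm{IntroVertex}_u}(w)=\{w\}$;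 $\widehat{\mathrm{ForgetVertex}_u}(R,s)=\{(R\setminus\{u\},s)\}$; $\widehat{\mathrm{IntroEdge}_{u,v}}(R,s)=\{(R,s)\}$ if $u\in R$ or $v\in R$, $\emptyset$ if $u,v\notin R$ and $s=r$, else $\{(R\cup\{u\},s+1),(R\cup\{v\},s+1)\}$; $\widehat{\mathrm{Join}}((R,s),(R',s'))=\{(R\cup R',s+s'-|R\cap R'|)\}$ if this value is $\le r$, else $\emptyset$.
   Formalization: Graphs are required to have exactly two distinct endpoints for every edge (multi-edges allowed, no loops or hyperedges); without this a single vertex with a loop has treewidth 0 and a vertex cover of size 1 but is not the graph of any term. *)

(* Defs.v *)
From mathcomp Require Import all_boot finmap.

Set Implicit Arguments.
Unset Strict Implicit.
Unset Printing Implicit Defensive.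

Local Open Scope fset_scope.
Local Obligation Tactic := idtac.

(* Multigraphs on finite subsets of nat: [(e, v) \in inc G] means that v is an
   endpoint of e.  Parallel edges are allowed; every edge has exactly two
   endpoints, so there are no loops, half-edges or hyperedges. *)
Record graph := Graph {
  verts : {fset nat};
  edges : {fset nat};
  inc : {fset nat * nat};
  inc_sub : forall e v, (e, v) \in inc -> e \in edges /\ v \in verts;
  edge_ends : forall e, e \in edges -> #|` [fset v in verts | (e, v) \in inc]| = 2
}.

Definition isomorphic (G H : graph) : Prop :=
  exists f g : nat -> nat,
    [/\ {in verts G &, injective f}, f @` verts G = verts H,
        {in edges G &, injective g}, g @` edges G = edges H &
        forall e v, e \in edges G -> v \in verts G ->
          ((e, v) \in inc G) = ((g e, f v) \in inc H)].

Definition vertex_cover (G : graph) (X : {fset nat}) : Prop :=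
  X `<=` verts G /\
  forall e, e \in edges G -> exists2 v, v \in X & (e, v) \in inc G.

Definition is_tree (T : finType) (adj : rel T) : Prop :=
  [/\ 0 < #|T|, symmetric adj, irreflexive adj,
      forall t t', connect adj t t' &
      forall c : seq T, 2 < size c -> ~ ucycle adj c].

Record tree_decomposition (G : graph) := TreeDecomposition {
  node : finType;
  adj : rel node;
  bag : node -> {fset nat};
  td_tree : is_tree adj;
  td_bag : forall t, bag t `<=` verts G;
  td_vert : forall v, v \in verts G -> exists t, v \in bag t;
  td_edge : forall e, e \in edges G ->
    exists t, forall v, (e, v) \in inc G -> v \in bag t;
  td_conn : forall v t t', v \in bag t -> v \in bag t' ->
    connect [rel x y | [&& adj x y, v \in bag x & v \in bag y]] t t'
}.

(* Truncated predecessor: the width is 0 instead of -1 if all bags are empty,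
   which is immaterial for the bounds [width D <= k] with k a natural number. *)
Definition width (G : graph) (D : tree_decomposition G) : nat :=
  (\max_(t : node D) #|` bag t|).-1.

Definition treewidth_at_most (k : nat) (G : graph) : Prop :=
  exists D : tree_decomposition G, width D <= k.

(* Terms over the alphabet Sigma_k; the labels 1, ..., k+1 are the elements
   0, ..., k of ['I_k.+1]. *)
Inductive term (k : nat) : Type :=
  | Leaf
  | IntroVertex (u : 'I_k.+1) of term k
  | ForgetVertex (u : 'I_k.+1) of term k
  | IntroEdge (u v : 'I_k.+1) of u != v & term k
  | Join of term k & term k.
Arguments Leaf {k}.

(* [reaches t B]: the tree automaton has a run on t that ends in state B. *)
Inductive reaches (k : nat) : term k -> {set 'I_k.+1} -> Prop :=
  | reaches_Leaf : reaches Leaf set0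
  | reaches_IntroVertex u t B :
      reaches t B -> u \notin B -> reaches (IntroVertex u t) (u |: B)
  | reaches_ForgetVertex u t B :
      reaches t B -> u \in B -> reaches (ForgetVertex u t) (B :\ u)
  | reaches_IntroEdge u v (uv : u != v) t B :
      reaches t B -> u \in B -> v \in B -> reaches (IntroEdge uv t) B
  | reaches_Join t1 t2 B :
      reaches t1 B -> reaches t2 B -> reaches (Join t1 t2) B.

Definition in_L (k : nat) (t : term k) : Prop := exists B, reaches t B.

(* [lab u] is the vertex carrying the label u, or None if u is not active. *)
Record lgraph (k : nat) := LGraph {
  lgr :> graph;
  lab : 'I_k.+1 -> option nat;
  lab_in : forall u x, lab u = Some x -> x \in verts lgr;
  lab_inj : forall u v x, lab u = Some x -> lab v = Some x -> u = v
}.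

Definition fresh (A : {fset nat}) : nat := (\max_(x <- A) x).+1.

Lemma freshP (A : {fset nat}) : fresh A \notin A.
Proof.
apply/negP => hA; have := @leq_bigmax_seq _ (enum_fset A) xpredT id _ hA isT.
by rewrite ltnn.
Qed.

Section Operations.
Variable k : nat.
Implicit Types (G : lgraph k) (u v : 'I_k.+1).

Lemma card_two (A : {fset nat}) (x y : nat) :
  x != y -> A =i [fset x; y] -> #|` A| = 2.
Proof. by move=> xy /fsetP ->; rewrite cardfs2 xy. Qed.

Lemma card_image (f : nat -> nat) (A B : {fset nat}) :
  injective f -> A =i f @` B -> #|` A| = #|` B|.
Proof. by move=> f_inj /fsetP ->; rewrite card_imfset. Qed.

Program Definition empty_lgraph : lgraph k :=
  @LGraph k (@Graph fset0 fset0 fset0 _ _) (fun=> None) _ _.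
Next Obligation. by []. Qed.
Next Obligation. by []. Qed.
Next Obligation. by []. Qed.
Next Obligation. by []. Qed.

Program Definition intro_vertex u G : lgraph k :=
  @LGraph k (@Graph (fresh (verts G) |` verts G) (edges G) (inc G) _ _)
    (fun l => if l == u then Some (fresh (verts G)) else lab G l) _ _.
Next Obligation.
by move=> u G e v /inc_sub [-> vG]; rewrite in_fset1U vG orbT.
Qed.
Next Obligation.
move=> u G e /edge_ends <-; congr #|` _|; apply/fsetP => v.
rewrite !inE; case: (boolP ((e, v) \in inc G)); rewrite ?andbF ?andbT //.
by case/inc_sub => _ ->; rewrite orbT.
Qed.
Next Obligation.
move=> u G l x /=; rewrite in_fset1U; case: eqP => [_ [->]|_ /lab_in ->].
  by rewrite eqxx.
by rewrite orbT.
Qed.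
Next Obligation.
move=> u G l l' x /=; have nf := freshP (verts G).
case: eqP => [->|_]; case: eqP => [->|_] //.
- by move=> [<-] /lab_in; rewrite (negbTE nf).
- by move=> h [fx]; move: h; rewrite -fx => /lab_in; rewrite (negbTE nf).
- exact: lab_inj.
Qed.

Program Definition forget_vertex u G : lgraph k :=
  @LGraph k G (fun l => if l == u then None else lab G l) _ _.
Next Obligation. by move=> u G l x /=; case: eqP => // _ /lab_in. Qed.
Next Obligation.
by move=> u G l l' x /=; case: eqP => // _; case: eqP => // _; apply: lab_inj.
Qed.

(* If u or v is not active, which does not happen on terms of L_k, nothing is
   added. *)
Definition new_edges u v G : {fset nat} :=
  if lab G u && lab G v then fresh (edges G) |` edges G else edges G.

Definition new_inc u v G : {fset nat * nat} :=
  let e := fresh (edges G) in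
  match lab G u, lab G v with
  | Some x, Some y => [fset (e, x); (e, y)] `|` inc G
  | _, _ => inc G
  end.

Program Definition intro_edge u v (uv : u != v) G : lgraph k :=
  @LGraph k (@Graph (verts G) (new_edges u v G) (new_inc u v G) _ _)
    (lab G) _ _.
Next Obligation.
move=> u v uv G d z; rewrite /new_edges /new_inc; set e := fresh _.
case Eu: (lab G u) => [x|]; case Ev: (lab G v) => [y|] /=; try exact: inc_sub.
rewrite !inE => /orP[/orP[]/eqP[-> ->]|/inc_sub[-> ->]]; last by rewrite orbT.
- by rewrite eqxx (lab_in Eu).
- by rewrite eqxx (lab_in Ev).
Qed.
Next Obligation.
move=> u v uv G d; rewrite /new_edges /new_inc; set e := fresh _.
case Eu: (lab G u) => [x|]; case Ev: (lab G v) => [y|] /=; try exact: edge_ends.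
have nf : e \notin edges G := freshP _.
rewrite in_fset1U => /orP[/eqP ->|dG].
  apply: (@card_two _ x y).
    by apply: contraNneq uv => xy; apply/eqP/(lab_inj Eu); rewrite xy.
  move=> z; rewrite !inE !xpair_eqE !eqxx /=.
  have -> : (((e, z) : nat * nat) \in inc G) = false.
    by apply/negP => /inc_sub [eG _]; rewrite eG in nf.
  rewrite orbF; case: eqP => [->|_] /=; first by rewrite (lab_in Eu).
  by case: eqP => [->|_] /=; [rewrite (lab_in Ev) | rewrite andbF].
rewrite -(edge_ends dG); congr #|` _|; apply/fsetP => z.
rewrite !inE !xpair_eqE; have -> : (d == e) = false.
  by apply/eqP => de; rewrite de (negbTE nf) in dG.
by [].
Qed.
Next Obligation. by move=> u v uv G l x; apply: lab_in. Qed.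
Next Obligation. by move=> u v uv G l l' x; apply: lab_inj. Qed.

(* The copies are made disjoint by x |-> 2x in G1 and y |-> 2y+1 in G2, except
   that a vertex of G2 with a label u is sent to the copy of the vertex of G1
   with label u. *)
Definition glue G1 G2 (y : nat) : nat :=
  if obind (lab G1) [pick u | lab G2 u == Some y] is Some x
  then x.*2 else y.*2.+1.

Lemma glue_inj G1 G2 : injective (glue G1 G2).
Proof.
have oddE x y : x.*2 = y.*2.+1 -> False.
  by move=> /(congr1 odd); rewrite /= !odd_double.
move=> y y'; rewrite /glue.
case: pickP => [u /eqP hu|_] /=; case: pickP => [u' /eqP hu'|_] /=.
- case E: (lab G1 u) => [x|]; case E': (lab G1 u') => [x'|].
  + move/double_inj => xx; rewrite -xx in E'.
    by move: hu'; rewrite -(lab_inj E E') hu => -[].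
  + by move/oddE.
  + by move/esym/oddE.
  + by case=> /double_inj.
- by case E: (lab G1 u) => [x|]; [move/oddE | case=> /double_inj].
- by case E: (lab G1 u') => [x|]; [move/esym/oddE | case=> /double_inj].
- by case=> /double_inj.
Qed.

Program Definition join G1 G2 : lgraph k :=
  @LGraph k
    (@Graph
       ([fset x.*2 | x in verts G1] `|` [fset glue G1 G2 y | y in verts G2])
       ([fset e.*2 | e in edges G1] `|` [fset e.*2.+1 | e in edges G2])
       ([fset (p.1.*2, p.2.*2) | p in inc G1] `|`
        [fset (p.1.*2.+1, glue G1 G2 p.2) | p in inc G2]) _ _)
    (fun u => omap double (lab G1 u)) _ _.
Next Obligation.
move=> G1 G2 e v; rewrite !in_fsetU => /orP[]/imfsetP[[d x] /= /inc_sub[dG xG] [-> ->]].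
  by split; apply/orP; left; apply/imfsetP; [exists d | exists x].
by split; apply/orP; right; apply/imfsetP; [exists d | exists x].
Qed.
Next Obligation.
have oddE x y : x.*2 = y.*2.+1 -> False.
  by move=> /(congr1 odd); rewrite /= !odd_double.
move=> G1 G2 e; rewrite in_fsetU => /orP[]/imfsetP[d /= dG ->].
  rewrite -(edge_ends dG); apply: (card_image double_inj) => v.
  rewrite !inE; apply/andP/imfsetP => /=.
    case=> _ /orP[]/imfsetP[[d' x] /= h [E ->]]; last by case: (oddE _ _ E).
    exists x => //; rewrite (double_inj E) !inE h andbT.
    by case/inc_sub: h.
  case=> x; rewrite !inE => /andP[xG h] ->; split; apply/orP; left;
    apply/imfsetP; [by exists x | by exists (d, x)].
rewrite -(edge_ends dG); apply: (card_image (@glue_inj G1 G2)) => v.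
rewrite !inE; apply/andP/imfsetP => /=.
  case=> _ /orP[]/imfsetP[[d' x] /= h [E ->]]; first by case: (oddE _ _ (esym E)).
  exists x => //; rewrite (double_inj E) !inE h andbT.
  by case/inc_sub: h.
case=> x; rewrite !inE => /andP[xG h] ->; split; apply/orP; right;
  apply/imfsetP; [by exists x | by exists (d, x)].
Qed.
Next Obligation.
move=> G1 G2 u x /=; case E: (lab G1 u) => [y|] //= [<-].
by rewrite in_fsetU; apply/orP; left; apply/imfsetP; exists y => //; apply: lab_in E.
Qed.
Next Obligation.
move=> G1 G2 u v x /=; case E: (lab G1 u) => [y|] //= [<-].
case E': (lab G1 v) => [y'|] //= [/double_inj yy]; rewrite yy in E'.
exact: lab_inj E E'.
Qed.

(* Total on terms; only its values on [in_L] are meaningful. *)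
Fixpoint graph_of (t : term k) : lgraph k :=
  match t with
  | Leaf => empty_lgraph
  | IntroVertex u s => intro_vertex u (graph_of s)
  | ForgetVertex u s => forget_vertex u (graph_of s)
  | IntroEdge u v uv s => intro_edge uv (graph_of s)
  | Join s1 s2 => join (graph_of s1) (graph_of s2)
  end.

End Operations.

(* The component C[k] of a DP-core over the instructive alphabets; the type A
   of values of Inv does not depend on k. *)
Record dp_component (A : Type) (k : nat) := DPComponent {
  witness : choiceType;
  final : pred witness;
  tr_Leaf : {fset witness};
  tr_IntroVertex : 'I_k.+1 -> witness -> {fset witness};
  tr_ForgetVertex : 'I_k.+1 -> witness -> {fset witness};
  tr_IntroEdge : forall u v : 'I_k.+1, u != v -> witness -> {fset witness};
  tr_Join : witness -> witness -> {fset witness};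
  clean : {fset witness} -> {fset witness};
  inv : {fset witness} -> A
}.

Definition dp_core (A : Type) := forall k : nat, dp_component A k.

Section Dynamic.
Variables (A : Type) (k : nat) (C : dp_component A k).

Definition ext1 (f : witness C -> {fset witness C}) (S : {fset witness C}) :=
  clean (\bigcup_(w <- S) f w).

Definition ext2 (f : witness C -> witness C -> {fset witness C})
    (S1 S2 : {fset witness C}) :=
  clean (\bigcup_(w1 <- S1) \bigcup_(w2 <- S2) f w1 w2).

Fixpoint Dyn (t : term k) : {fset witness C} :=
  match t with
  | Leaf => tr_Leaf C
  | IntroVertex u s => ext1 (tr_IntroVertex u) (Dyn s)
  | ForgetVertex u s => ext1 (tr_ForgetVertex u) (Dyn s)
  | IntroEdge u v uv s => ext1 (tr_IntroEdge uv) (Dyn s)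
  | Join s1 s2 => ext2 (@tr_Join _ _ C) (Dyn s1) (Dyn s2)
  end.

Definition accepted (t : term k) : Prop := exists2 w, w \in Dyn t & final w.

(* P(C[k], I), as a predicate on graphs. *)
Definition graph_property (H : graph) : Prop :=
  exists t : term k, [/\ in_L t, accepted t & isomorphic (graph_of t) H].

End Dynamic.

Definition coherent (A : Type) (C : dp_core A) : Prop :=
  forall (k k' : nat) (t : term k) (t' : term k'),
    in_L t -> in_L t' -> isomorphic (graph_of t) (graph_of t') ->
    (accepted (C k) t <-> accepted (C k') t') /\
    inv (Dyn (C k) t) = inv (Dyn (C k') t').

Section VertexCover.
Variables (r k : nat).

Definition vc_witness : finType := ({set 'I_k.+1} * 'I_r.+1)%type.
Implicit Types (w : vc_witness) (S : {fset vc_witness}).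

Definition vc_ForgetVertex (u : 'I_k.+1) w : {fset vc_witness} :=
  [fset (w.1 :\ u, w.2)].

Definition vc_IntroEdge (u v : 'I_k.+1) w : {fset vc_witness} :=
  let: (R, s) := w in
  if (u \in R) || (v \in R) then [fset (R, s)]
  else if s == r :> nat then fset0
  else [fset (u |: R, inord s.+1); (v |: R, inord s.+1)].

(* The subtraction is truncated; it never truncates when #|R| <= s and
   #|R'| <= s', which holds for every witness that occurs in a computation. *)
Definition vc_Join w w' : {fset vc_witness} :=
  let: (R, s) := w in
  let: (R', s') := w' in
  let m := s + s' - #|R :&: R'| in
  if m <= r then [fset (R :|: R', inord m)] else fset0.

Definition vc_clean S : {fset vc_witness} :=
  [fset w in S | ~~ [exists s' : 'I_r.+1, ((w.1, s') \in S) && (s' < w.2)]].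

(* The minimum of an empty set is None.  The starting value r of the iterated
   minimum is harmless since all sizes are at most r. *)
Definition vc_inv S : option nat :=
  if S == fset0 then None
  else Some (\big[minn/r]_(w <- S) (w.2 : nat)).

Definition VC_component : dp_component (option nat) k :=
  @DPComponent (option nat) k vc_witness
    predT
    [fset (set0, ord0)]
    (fun _ w => [fset w])
    vc_ForgetVertex
    (fun u v _ => vc_IntroEdge u v)
    vc_Join
    vc_clean
    vc_inv.

End VertexCover.

Definition VC (r : nat) : dp_core (option nat) := VC_component r.

(* Main.v *)
Require Import Defs.
From mathcomp Require Import all_boot finmap zify.

(* The dynamic program only ever adds a vertex to a partial cover when an edge
   forces it.  Its witnesses (R, s) are therefore active parts R and sizes s of
   genuine vertex covers, and conversely every vertex cover X with at most r
   elements dominates a witness, i.e. there is one with R inside the active part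
   of X and with at most as many forgotten vertices.  Hence the smallest s that
   occurs is the vertex cover number, which depends on the graph only.

   The graphs of the terms are those of treewidth at most k because both are
   described by sequences of bags with the running intersection property.  A
   tree decomposition is listed by growing a subtree one adjacent node at a
   time; such a list yields a colouring of the vertices by k+1 labels injective
   on every bag, and merging leaf bags into their parents builds a term. *)

Set Implicit Arguments.
Unset Strict Implicit.
Unset Printing Implicit Defensive.

Local Open Scope fset_scope.

(** * Isomorphisms, active labels and gluing *)

Lemma double_neq_doubleS x y : (x.*2 == y.*2.+1) = false.
Proof. by apply/eqP => /(congr1 odd); rewrite /= !odd_double. Qed.

Lemma mem_double_fset (X : {fset nat}) x :
  (x.*2 \in [fset y.*2 | y in X]) = (x \in X).
Proof. exact: (mem_imfset _ _ double_inj). Qed.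

(** The maps of an isomorphism are injective only on [verts G] and [edges G], so inverses have to be
    chosen on the images, with a dummy value elsewhere. *)
Lemma isomorphic_sym G H : isomorphic G H -> isomorphic H G.
Proof.
suff inv_on (A B : {fset nat}) (f : nat -> nat) :
    {in A &, injective f} -> f @` A = B ->
    exists f', [/\ {in B, forall y, f' y \in A}, {in B, cancel f' f},
      {in B &, injective f'} & f' @` B = A].
  case=> f [g [fI fE gI gE incE]].
  have [f' [f'A f'K f'I f'E]] := inv_on _ _ _ fI fE.
  have [g' [g'A g'K g'I g'E]] := inv_on _ _ _ gI gE.
  exists f', g'; split=> // e v eH vH.
  by rewrite incE ?f'A ?g'A // g'K ?f'K.
move=> fI <-; pose f' y := if [pick x : A | f (val x) == y] is Some x then val x else 0.
have f'P x : x \in A -> f' (f x) = x.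
  rewrite /f' => xA; case: pickP => [x' /eqP /fI -> //|/(_ [` xA])] /=.
    by apply: valP.
  by rewrite eqxx.
exists f'; split.
- by move=> _ /imfsetP[x /= xA ->]; rewrite f'P.
- by move=> _ /imfsetP[x /= xA ->]; rewrite f'P.
- by move=> _ _ /imfsetP[x /= xA ->] /imfsetP[y /= yA ->]; rewrite !f'P // => ->.
apply/fsetP => x; apply/imfsetP/idP => [[_ /imfsetP[y /= yA ->] ->]|xA].
  by rewrite f'P.
by exists (f x); rewrite ?f'P ?in_imfset.
Qed.

Lemma isomorphic_vertex_cover G H X :
  isomorphic G H -> vertex_cover G X ->
  exists2 Y, vertex_cover H Y & #|` Y| = #|` X|.
Proof.
case=> f [g [fI fE gI gE incE]] [/fsubsetP XG Xc].
exists (f @` X); last by rewrite card_in_imfset // => x y /XG xG /XG yG; apply: fI.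
split; first by rewrite -fE; apply/fsubsetP => _ /imfsetP[x /= /XG xG ->]; rewrite in_imfset.
rewrite -gE => _ /imfsetP[e /= eG ->]; have [v vX ev] := Xc e eG.
exists (f v); first by rewrite in_imfset.
by rewrite -incE // XG.
Qed.

Section Labels.
Variable k : nat.
Implicit Types (G : lgraph k) (t : term k) (B : {set 'I_k.+1}).

Definition lab_set G : {set 'I_k.+1} := [set u | isSome (lab G u)].

(** This turns the side conditions of a run into facts about [lab]; in particular, both sides of a
    join carry the same labels. *)
Lemma reaches_lab_set t B : reaches t B -> lab_set (graph_of t) = B.
Proof.
elim=> {t B} [|u t B _ IH uB|u t B _ IH uB|u v uv t B _ IH uB vB|t1 t2 B _ IH1 _ _];
  apply/setP => l; rewrite ?inE /=.
- by [].
- by rewrite -IH inE; case: eqP.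
- by rewrite -IH inE; case: eqP.
- by rewrite -IH inE.
- by rewrite -IH1 inE; case: lab.
Qed.

Definition trace G (X : {fset nat}) : {set 'I_k.+1} :=
  [set u | if lab G u is Some x then x \in X else false].

Section Glue.
Variables G1 G2 : lgraph k.
Hypothesis lab12 : lab_set G1 = lab_set G2.

Lemma glue_lab u x y : lab G1 u = Some x -> lab G2 u = Some y -> glue G1 G2 y = x.*2.
Proof.
move=> ux uy; rewrite /glue; case: pickP => [v /eqP vy|/(_ u)]; last by rewrite uy eqxx.
by rewrite (lab_inj vy uy) /= ux.
Qed.

Variant glue_spec y : nat -> Prop :=
  | GlueLab u x of lab G1 u = Some x & lab G2 u = Some y : glue_spec y x.*2
  | GlueFree of (forall u, lab G2 u <> Some y) : glue_spec y y.*2.+1.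

(** Since both graphs carry the same labels, the default branch of [glue] is taken exactly for the
    unlabelled vertices of [G2]. *)
Lemma glueP y : glue_spec y (glue G1 G2 y).
Proof.
rewrite /glue; case: pickP => [u /eqP uy|uN] /=; last first.
  by apply: GlueFree => u uy; have := uN u; rewrite uy eqxx.
have : u \in lab_set G2 by rewrite inE uy.
by rewrite -lab12 inE; case ux: (lab G1 u) => [x|] // _; apply: GlueLab ux uy.
Qed.

Lemma glue_eq_double x y : glue G1 G2 y = x.*2 ->
  exists2 u, lab G1 u = Some x & lab G2 u = Some y.
Proof.
case: glueP => [u x' ux uy /double_inj <-|_ /esym/eqP]; first by exists u.
by rewrite double_neq_doubleS.
Qed.

Definition glue_fset (X1 X2 : {fset nat}) : {fset nat} :=
  [fset x.*2 | x in X1] `|` [fset glue G1 G2 y | y in X2].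

Lemma mem_glue_image (X : {fset nat}) y :
  (glue G1 G2 y \in [fset glue G1 G2 z | z in X]) = (y \in X).
Proof. exact: (mem_imfset _ _ (@glue_inj _ G1 G2)). Qed.

Lemma trace_join X1 X2 :
  trace (join G1 G2) (glue_fset X1 X2) = trace G1 X1 :|: trace G2 X2.
Proof.
apply/setP => u; rewrite !inE /=.
have : (u \in lab_set G1) = (u \in lab_set G2) by rewrite lab12.
rewrite !inE; case ux: (lab G1 u) => [x|]; case uy: (lab G2 u) => [y|] //= _.
by rewrite in_fsetU mem_double_fset -(glue_lab ux uy) mem_glue_image.
Qed.

(** The two images overlap exactly in the vertices whose label lies in both traces; this is the term
    subtracted in [vc_Join]. *)
Lemma card_glue_fset X1 X2 :
  #|` glue_fset X1 X2| = #|` X1| + #|` X2| - #|trace G1 X1 :&: trace G2 X2|.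
Proof.
rewrite /glue_fset cardfsU card_imfset ?(card_imfset _ _ (@glue_inj _ G1 G2)); last exact: double_inj.
congr (_ - _); set I := _ `&` _; set R := _ :&: _.
(* [h] maps the common labels bijectively onto the overlap; its default 0 is never taken on [R],
   whose labels are active. *)
pose h (u : 'I_k.+1) : nat := if lab G1 u is Some x then x.*2 else 0.
have hI : {in R &, injective h}.
  move=> u v; rewrite !inE /h; case ux: (lab G1 u) => [x|] // _.
  by case vx: (lab G1 v) => [y|] // _ /double_inj xy; rewrite -xy in vx; apply: lab_inj ux vx.
rewrite cardE -(size_map h).
have -> : I = [fset x | x in map h (enum R)].
  apply/fsetP => z; rewrite !inE /=; apply/andP/mapP.
    case=> /imfsetP[x /= xX ->] /imfsetP[y /= yX /esym /glue_eq_double [u ux uy]].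
    by exists u; rewrite ?mem_enum ?inE /h ux // uy xX.
  case=> u; rewrite mem_enum !inE /h; case ux: (lab G1 u) => [x|] //.
  case uy: (lab G2 u) => [y|]; rewrite ?andbF // => /andP[xX yX] ->.
  by split; [rewrite in_imfset | rewrite -(glue_lab ux uy) in_imfset].
rewrite card_fseq undup_id // map_inj_in_uniq ?enum_uniq // => u v.
by rewrite !mem_enum; apply: hI.
Qed.

End Glue.
End Labels.

(** * The dynamic program computes vertex covers *)

(* [lia] does not see through the unification hint [reverse_coercion], which
   makes equal cardinals look like distinct atoms. *)
Ltac card_lia := unfold reverse_coercion in *; lia.

Section Correctness.
Variables r k : nat.
Implicit Types (t : term k) (B R : {set 'I_k.+1}) (S : {fset vc_witness r k}).

Lemma clean_sub S w : w \in vc_clean S -> w \in S.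
Proof. by rewrite !inE => /andP[]. Qed.

(** The smallest size paired with [R] survives cleaning. Completeness needs no more, because its
    inequality only improves when [s] decreases. *)
Lemma clean_le S R s : (R, s) \in S ->
  exists2 s' : 'I_r.+1, (R, s') \in vc_clean S & s' <= s.
Proof.
move=> RS; pose s0 := [arg min_(i < s | (R, i) \in S) (i : nat)].
have [] : ((R, s0) \in S) /\ (forall i, (R, i) \in S -> s0 <= i).
  by rewrite /s0; case: arg_minnP.
move=> s0S s0_min; exists s0; last exact: s0_min.
rewrite !inE s0S /=; apply/existsPn => s'; apply/negP => /andP[/s0_min].
by rewrite /= leqNgt => /negbTE ->.
Qed.

(** Every transition is imitated on covers: introducing and forgetting a vertex keep the cover, an
    uncovered edge adds one endpoint, and a join glues. Cleaning only removes witnesses. *)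
Lemma vc_sound t B R s : reaches t B -> (R, s) \in Dyn (VC_component r k) t ->
  exists X, [/\ vertex_cover (graph_of t) X, #|` X| = s & trace (graph_of t) X = R].
Proof.
move=> tB; elim: tB R s => {t B}
  [|u t B tB IH uB|u t B tB IH uB|u v uv t B tB IH uB vB|t1 t2 B tB1 IH1 tB2 IH2] R s /=.
- rewrite inE => /eqP[-> ->]; exists fset0; split=> //.
- move/clean_sub/bigfcupP => [[R' s'] /andP[/IH[X [[XG Xc] Xs XR]] _]].
  rewrite inE => /eqP[-> ->]; exists X; split=> //.
    split=> //; apply: fsubset_trans XG _; exact: fsubsetU1.
  (* At [u] both traces are empty: the label was inactive before, and the fresh vertex is not in
     [X]. *)
  rewrite -XR; apply/setP => l; rewrite !inE /=; case: eqP => // ->.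
  have := reaches_lab_set tB; move/setP/(_ u); rewrite inE (negbTE uB).
  case: lab => // _; apply/negP => /(fsubsetP XG); apply/negP; exact: freshP.
- move/clean_sub/bigfcupP => [[R' s'] /andP[/IH[X [[XG Xc] Xs XR]] _]].
  rewrite inE => /eqP[-> ->]; exists X; split=> //.
  by rewrite -XR; apply/setP => l; rewrite !inE /=; case: eqP.
- move/clean_sub/bigfcupP => [[R' s'] /andP[/IH[X [[XG Xc] Xs XR]] _]].
  have labE := reaches_lab_set tB.
  move: uB vB; rewrite -labE !inE; case Eu: (lab _ u) => [x|//] _; case Ev: (lab _ v) => [y|//] _.
  have cover_add (Y : {fset nat}) : X `<=` Y -> Y `<=` verts (graph_of t) -> (x \in Y) || (y \in Y) ->
      vertex_cover (graph_of (IntroEdge uv t)) Y.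
    move=> XY YG xyY; split=> // e; rewrite /= /new_edges /new_inc Eu Ev in_fset1U.
    case/orP => [/eqP ->|/Xc[z zX ez]].
      by case/orP: xyY => h; [exists x | exists y]; rewrite // !inE eqxx ?orbT.
    by exists z; [apply: (fsubsetP XY) | rewrite inE ez orbT].
  have trace_add l z : lab (graph_of t) l = Some z ->
      trace (graph_of t) (z |` X) = l |: R'.
    move=> lz; rewrite -XR; apply/setP => l'; rewrite !inE.
    case El: (lab _ l') => [z'|].
      rewrite !inE; congr (_ || _); apply/eqP/eqP => [zz|ll].
        by apply: lab_inj El _; rewrite zz.
      by move: El; rewrite ll lz => -[].
    by rewrite orbF; apply/esym/eqP => ll; rewrite ll lz in El.
  have inR l z : lab (graph_of t) l = Some z -> (l \in R') = (z \in X).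
    by move=> lz; rewrite -XR inE lz.
  rewrite /=; case: ifP => [uvR|].
    rewrite inE => /eqP[-> ->]; exists X; split=> //.
    by apply: cover_add; rewrite -?(inR _ _ Eu) -?(inR _ _ Ev).
  rewrite (inR _ _ Eu) (inR _ _ Ev) => /norP[xX yX]; case: eqP => [//|/eqP sr].
  (* In this branch [s'] is below [r], so [s'.+1] is in range for [inord]. *)
  have s1 : (inord s'.+1 : 'I_r.+1) = s'.+1 :> nat.
    by rewrite inordK // ltnS ltn_neqAle sr -ltnS ltn_ord.
  rewrite !inE => /orP[]/eqP[-> ->].
    exists (x |` X); rewrite s1 cardfsU1 xX Xs; split=> //; last exact: trace_add.
    by apply: cover_add; rewrite ?fsubsetU1 ?inE ?eqxx // fsubUset fsub1set (lab_in Eu) XG.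
  exists (y |` X); rewrite s1 cardfsU1 yX Xs; split=> //; last exact: trace_add.
  by apply: cover_add; rewrite ?fsubsetU1 ?inE ?eqxx ?orbT // fsubUset fsub1set (lab_in Ev) XG.
move/clean_sub/bigfcupP => [[R1 s1] /andP[/IH1[X1 [[XG1 Xc1] Xs1 XR1]] _]].
move/bigfcupP => [[R2 s2] /andP[/IH2[X2 [[XG2 Xc2] Xs2 XR2]] _]] /=.
case: ifP => // sr; rewrite inE => /eqP[-> ->].
have lab12 : lab_set (graph_of t1) = lab_set (graph_of t2).
  by rewrite (reaches_lab_set tB1) (reaches_lab_set tB2).
exists (glue_fset (graph_of t1) (graph_of t2) X1 X2); split.
- split; first by apply: fsetUSS; apply: subset_imfset; apply/fsubsetP.
  move=> e; rewrite in_fsetU => /orP[]/imfsetP[d /= dG ->].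
    have [x xX dx] := Xc1 d dG; exists x.*2; rewrite in_fsetU; apply/orP; left.
      by rewrite mem_double_fset.
    by apply/imfsetP; exists (d, x).
  have [x xX dx] := Xc2 d dG; exists (glue (graph_of t1) (graph_of t2) x);
    rewrite in_fsetU; apply/orP; right.
    by rewrite mem_glue_image.
  by apply/imfsetP; exists (d, x).
- by rewrite card_glue_fset // XR1 XR2 Xs1 Xs2 inordK.
- by rewrite trace_join // XR1 XR2.
Qed.

Lemma card_trace (G : lgraph k) (X : {fset nat}) : #|trace G X| <= #|` X|.
Proof.
pose h u := odflt 0 (lab G u).
rewrite cardE -(size_map h); apply: uniq_leq_size.
  rewrite map_inj_in_uniq ?enum_uniq // => a b; rewrite !mem_enum !inE /h.
  case Ea: (lab G a) => [z|//]; case Eb: (lab G b) => [z'|//] _ _ /= zz.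
  by rewrite -zz in Eb; apply: lab_inj Ea Eb.
by move=> z /mapP[a]; rewrite mem_enum inE /h; case: (lab G a) => [z'|//] ? ->.
Qed.

Lemma cardsU1_notin (T : finType) (u : T) (A : {set T}) : u \notin A -> #|u |: A| = #|A|.+1.
Proof. by move=> uA; rewrite cardsU1 uA. Qed.

(* The inequality says that the witness has at most as many forgotten vertices
   as X: [s - #|R| <= #|X| - #|trace X|]. *)
Lemma vc_complete t B X :
  reaches t B -> vertex_cover (graph_of t) X -> #|` X| <= r ->
  exists (R : {set 'I_k.+1}) (s : 'I_r.+1),
    [/\ (R, s) \in Dyn (VC_component r k) t, R \subset trace (graph_of t) X &
        s + #|trace (graph_of t) X| <= #|` X| + #|R|].
Proof.
move=> tB; elim: tB X => {t B}
  [|u t B tB IH uB|u t B tB IH uB|u v uv t B tB IH uB vB|t1 t2 B tB1 IH1 tB2 IH2] X.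
- case=> XG _ _; exists set0, ord0; split; rewrite ?inE ?sub0set //.
  by have := card_trace (empty_lgraph k) X; rewrite cards0 /=; card_lia.
- set x := fresh (verts (graph_of t)).
  (* The fresh vertex is isolated, so [X] without it covers the old graph. If it lies in [X], the
     cover and its trace both grow by one and the inequality is kept. *)
  case=> XG Xc Xr; have [||R [s [Rs RX sX]]] := IH (X `\ x).
  + split; first by rewrite fsubDset.
    move=> e eG; have [v vX ev] := Xc e eG; exists v => //; rewrite !inE vX andbT.
    apply/eqP => vx; have [_] := @inc_sub (graph_of t) _ _ ev.
    by rewrite vx (negbTE (freshP _)).
  + by apply: leq_trans Xr; apply/fsubset_leq_card/fsubD1set.
  have [s' Rs' ss'] : exists2 s' : 'I_r.+1, (R, s') \in Dyn (VC_component r k) (IntroVertex u t) & s' <= s.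
    by apply: clean_le; apply/bigfcupP; exists (R, s); rewrite ?Rs ?inE.
  have uN : u \notin trace (graph_of t) (X `\ x).
    rewrite inE; have := reaches_lab_set tB; move/setP/(_ u); rewrite inE (negbTE uB).
    by case: lab.
  have TE : trace (graph_of (IntroVertex u t)) X =
      if x \in X then u |: trace (graph_of t) (X `\ x) else trace (graph_of t) (X `\ x).
    apply/setP => l; case: ifP => xX; rewrite !inE /=; case: (altP (l =P u)) => [->|_] //=.
    * case lz: (lab _ l) => [z|//]; rewrite !inE.
      by case: eqP => // zx; have := lab_in lz; rewrite zx (negbTE (freshP _)).
    * by rewrite -/x xX; move: uN; rewrite inE => /negbTE ->.
    case lz: (lab _ l) => [z|//]; rewrite !inE.
    by case: eqP => // zx; have := lab_in lz; rewrite zx (negbTE (freshP _)).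
  exists R, s'; split=> //; rewrite TE; first by case: ifP => // _; apply: subset_trans RX _; apply: subsetUr.
  have h : s' + #|trace (graph_of t) (X `\ x)| <= #|` X `\ x| + #|R|.
    by apply: leq_trans sX; rewrite leq_add2r.
  by rewrite (cardfsD1 x X); case: ifP => xX //; rewrite cardsU1_notin // addnS -addnA ltnS.
- case=> XG Xc Xr; have [|//|R [s [Rs RX sX]]] := IH X; first by split.
  have [s' Rs' ss'] : exists2 s' : 'I_r.+1, (R :\ u, s') \in Dyn (VC_component r k) (ForgetVertex u t) & s' <= s.
    by apply: clean_le; apply/bigfcupP; exists (R, s); rewrite ?Rs ?inE.
  have TE : trace (graph_of (ForgetVertex u t)) X = trace (graph_of t) X :\ u.
    by apply/setP => l; rewrite !inE /=; case: eqP.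
  exists (R :\ u), s'; split=> //; rewrite TE; first exact: setSD.
  (* As [R] lies in the trace, [u] leaves both sets, or the trace only, or neither; the inequality
     survives each time. *)
  have := cardsD1 u R; have := cardsD1 u (trace (graph_of t) X).
  by move/subsetP/(_ u): RX; case: (u \in R) => [->//|_]; case: (u \in trace (graph_of t) X); card_lia.
- move: uB vB; rewrite -(reaches_lab_set tB) !inE.
  case Eu: (lab _ u) => [x|//] _; case Ev: (lab _ v) => [y|//] _.
  case=> XG Xc Xr; have [|//|R [s [Rs RX sX]]] := IH X.
    split=> // e eG; have [|z zX] := Xc e; first by rewrite /= /new_edges Eu Ev inE eG orbT.
    rewrite /= /new_inc Eu Ev !inE !xpair_eqE => ez; exists z => //.
    suff en : e != fresh (edges (graph_of t)) by move: ez; rewrite (negbTE en).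
    by apply: contraTneq eG => ->; apply: freshP.
  suff [R' [s1 [Rs1 R'X s1X]]] : exists (R' : {set 'I_k.+1}) (s1 : 'I_r.+1),
      [/\ (R', s1) \in vc_IntroEdge u v (R, s), R' \subset trace (graph_of t) X &
          s1 + #|trace (graph_of t) X| <= #|` X| + #|R'|].
    have [s' Rs' ss'] : exists2 s' : 'I_r.+1, (R', s') \in Dyn (VC_component r k) (IntroEdge uv t) & s' <= s1.
      by apply: clean_le; apply/bigfcupP; exists (R, s); rewrite ?Rs.
    by exists R', s'; split=> //; apply: leq_trans s1X; rewrite leq_add2r.
  rewrite /=; case: ifP => [_|/norP[uR vR]]; first by exists R, s; rewrite inE.
  (* [X] contains an endpoint [w] of the new edge, and [R] contains neither endpoint; the witness
     follows [X] by adding [w]. *)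
  have [w [wX wR wuv]] : exists w, [/\ w \in trace (graph_of t) X, w \notin R & (w == u) || (w == v)].
    have [|z zX] := Xc (fresh (edges (graph_of t))); first by rewrite /= /new_edges Eu Ev !inE eqxx.
    rewrite /= /new_inc Eu Ev !inE !xpair_eqE eqxx /=.
    have -> /= : ((fresh (edges (graph_of t)), z) \in inc (graph_of t)) = false.
      by apply/negP => /inc_sub[]; rewrite (negbTE (freshP _)).
    rewrite orbF => /orP[]/eqP zE; rewrite zE in zX.
      by exists u; rewrite inE Eu eqxx.
    by exists v; rewrite inE Ev eqxx orbT.
  have RwX : w |: R \subset trace (graph_of t) X by rewrite subUset sub1set wX.
  (* [R] is strictly smaller than the trace, so [s] is below the size of [X], hence below [r]: the
     branch that discards the witness cannot occur. *)
  have := subset_leq_card RwX; rewrite cardsU1_notin // => Rlt.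
  case: eqP => [sr|sr]; first card_lia.
  exists (w |: R), (inord s.+1); rewrite inordK; last by have := ltn_ord s; card_lia.
  split=> //; last by rewrite cardsU1_notin // addSn addnS ltnS.
  by rewrite !inE; case/orP: wuv => /eqP ->; rewrite eqxx ?orbT.
set G1 := graph_of t1; set G2 := graph_of t2.
have lab12 : lab_set G1 = lab_set G2.
  by rewrite (reaches_lab_set tB1) (reaches_lab_set tB2).
case=> XG Xc Xr.
(* These are the parts of [X] in the two copies. Both have the trace of [X], so their overlap has
   exactly as many vertices as that trace. *)
pose X1 := [fset x in verts G1 | x.*2 \in X].
pose X2 := [fset y in verts G2 | glue G1 G2 y \in X].
have XE : X = glue_fset G1 G2 X1 X2.
  apply/fsetP => z; rewrite in_fsetU; apply/idP/orP => [zX|[]/imfsetP[x /=]].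
  - move/fsubsetP/(_ z zX): XG; rewrite /= in_fsetU => /orP[]/imfsetP[x /= xG zE]; [left|right];
      by apply/imfsetP; exists x; rewrite // !inE xG -zE.
  - by rewrite !inE => /andP[_ ?] ->.
  - by rewrite !inE => /andP[_ ?] ->.
have T1 : trace G1 X1 = trace (join G1 G2) X.
  apply/setP => l; rewrite !inE /=; case El: (lab G1 l) => [x|] //=.
  by rewrite !inE (lab_in El).
have T2 : trace G2 X2 = trace (join G1 G2) X.
  apply/setP => l; rewrite !inE /=; move/setP/(_ l): lab12; rewrite !inE.
  case El: (lab G1 l) => [x|]; case El2: (lab G2 l) => [y|] //= _.
  by rewrite !inE (lab_in El2) (glue_lab El El2).
have Xs : (#|` X| + #|trace (join G1 G2) X| = #|` X1| + #|` X2|)%N.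
  have := card_glue_fset lab12 X1 X2; rewrite -XE T1 T2 setIid.
  have := card_trace G1 X1.
  rewrite T1 /= -/G1 -/G2; card_lia.
have TX1 := card_trace G1 X1; have TX2 := card_trace G2 X2; rewrite T1 in TX1; rewrite T2 in TX2.
have [||R1 [s1 [Rs1 RX1 sX1]]] := IH1 X1.
- split; first by apply/fsubsetP => x; rewrite !inE => /andP[].
  move=> e eG; have [|z zX] := Xc e.*2.
    by rewrite /= in_fsetU mem_double_fset eG.
  rewrite /= in_fsetU => /orP[]/imfsetP[[d x] /= dx [] ed zE]; last first.
    by move/eqP: ed; rewrite double_neq_doubleS.
  exists x; last by rewrite (double_inj ed).
  by rewrite !inE -zE zX andbT; case/inc_sub: dx.
- card_lia.
have [||R2 [s2 [Rs2 RX2 sX2]]] := IH2 X2.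
- split; first by apply/fsubsetP => x; rewrite !inE => /andP[].
  move=> e eG; have [|z zX] := Xc e.*2.+1.
    by rewrite /= in_fsetU orbC; apply/orP; left; apply/imfsetP; exists e.
  rewrite /= in_fsetU => /orP[]/imfsetP[[d x] /= dx [] ed zE].
    by move/esym/eqP: ed; rewrite double_neq_doubleS.
  exists x; last by rewrite (double_inj ed).
  by rewrite !inE -zE zX andbT; case/inc_sub: dx.
- card_lia.
have RT : R1 :|: R2 \subset trace (join G1 G2) X by rewrite subUset -{1}T1 -T2 RX1.
(* Here [a], [b] are the witness sizes, [i] and [u] count the intersection and the union of [R1] and
   [R2], [x] counts the trace, and [y], [z], [c] are the sizes of [X1], [X2], [X]. Adding the two
   induction inequalities and cancelling gives the second claim, from which [u <= x] gives the
   first; [x <= y] covers a truncated difference. *)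
have arith (a b i u x x1 x2 y z c : nat) : i <= x1 -> u = x1 + x2 - i -> u <= x ->
    (c + x = y + z)%N -> c <= r -> x <= y -> a + x <= y + x1 -> b + x <= z + x2 ->
    a + b - i <= r /\ a + b - i + x <= c + u by lia.
rewrite -/G1 T1 in sX1; rewrite -/G2 T2 in sX2.
have [sr sX] := arith _ _ _ _ _ _ _ _ _ _ (subset_leq_card (subsetIl R1 R2)) (cardsU R1 R2)
  (subset_leq_card RT) Xs Xr TX1 sX1 sX2.
have [s' Rs' ss'] : exists2 s' : 'I_r.+1,
    (R1 :|: R2, s') \in Dyn (VC_component r k) (Join t1 t2) & s' <= (inord (s1 + s2 - #|R1 :&: R2|) : 'I_r.+1).
  apply: clean_le; apply/bigfcupP; exists (R1, s1); rewrite ?Rs1 //.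
  by apply/bigfcupP; exists (R2, s2); rewrite ?Rs2 //= sr inE.
exists (R1 :|: R2), s'; split=> //; apply: leq_trans sX.
by rewrite inordK // in ss'; rewrite leq_add2r.
Qed.
End Correctness.

(** * Acceptance, minimum size and coherence *)

Lemma vc_acceptedP r k (t : term k) B : reaches t B ->
  accepted (VC r k) t <-> exists2 X, vertex_cover (graph_of t) X & #|` X| <= r.
Proof.
move=> tB; split=> [[[R s] /(vc_sound tB)[X [Xc Xs _]] _]|[X Xc /(vc_complete tB Xc)[R [s [Rs _ _]]]]].
  by exists X; rewrite // Xs -ltnS.
by exists (R, s).
Qed.

(** Both minima start from [r], an upper bound for all sizes, so an empty [S] needs no separate
    case. *)
Lemma vc_inv_le r k k' (S : {fset vc_witness r k}) (S' : {fset vc_witness r k'}) :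
  (forall w, w \in S -> exists2 w', w' \in S' & w'.2 <= w.2) ->
  \big[minn/r]_(w <- S') (w.2 : nat) <= \big[minn/r]_(w <- S) (w.2 : nat).
Proof.
have le_r : \big[minn/r]_(w <- S') (w.2 : nat) <= r.
  by apply: (big_ind (fun n => n <= r)) => // [m n mr _|w _]; [rewrite geq_min mr | rewrite -ltnS].
have le_w w' : w' \in S' -> \big[minn/r]_(w <- S') (w.2 : nat) <= w'.2.
  rewrite -[w' \in S']/(w' \in enum_fset S'); elim: (enum_fset S') => // w1 s IHs.
  by rewrite inE big_cons geq_min => /orP[/eqP ->|/IHs ->]; rewrite ?leqnn ?orbT.
move=> SS'; set b := leqLHS; rewrite big_seq.
apply: (big_ind (fun n => b <= n)) => // [m n bm bn|w /SS'[w' /le_w w'S ww']].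
  by rewrite leq_min bm.
exact: leq_trans ww'.
Qed.

Lemma vc_coherent r : coherent (VC r).
Proof.
(* A witness of [t] yields a cover, its image covers the other graph, and completeness returns a
   witness of [t'] that is no larger. Only sizes are compared, since the labels of [t] and [t'] are
   unrelated. *)
have dom k k' (t : term k) (t' : term k') B B' : reaches t B -> reaches t' B' ->
    isomorphic (graph_of t) (graph_of t') -> forall w, w \in Dyn (VC r k) t ->
    exists2 w', w' \in Dyn (VC r k') t' & w'.2 <= w.2.
  move=> tB tB' iso [R s] /(vc_sound tB)[X [Xc Xs _]].
  have [Y Yc YX] := isomorphic_vertex_cover iso Xc.
  have Yr : #|` Y| <= r by rewrite YX Xs -ltnS.
  have [R' [s' [Rs' RY sY]]] := vc_complete tB' Yc Yr.
  exists (R', s') => //=; rewrite -Xs -YX.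
  have arith a b x y : a + x <= b + y -> y <= x -> a <= b by lia.
  exact: arith sY (subset_leq_card RY).
move=> k k' t t' [B tB] [B' tB'] iso.
have d1 := dom _ _ _ _ _ _ tB tB' iso; have d2 := dom _ _ _ _ _ _ tB' tB (isomorphic_sym iso).
split; first by split=> -[w]; [case/d1 | case/d2] => w' w'S _; exists w'.
rewrite /= /vc_inv.
have -> : (Dyn (VC r k) t == fset0) = (Dyn (VC r k') t' == fset0).
  apply/idP/idP; apply: contraTT => /fset0Pn[w]; [case/d2 | case/d1] => w' w'S _; apply/fset0Pn; by exists w'.
case: ifP => // _; congr Some; apply/eqP.
by rewrite eqn_leq !vc_inv_le.
Qed.

(** * Tree decompositions as sequences of bags *)

(* The running intersection property: C is the parent of B in the tree of bags,
   whose root is the last bag. *)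
Inductive rip : seq {fset nat} -> Prop :=
  | rip_one B : rip [:: B]
  | rip_cons B C s : rip s -> C \in s ->
      (forall A, A \in s -> A `&` B `<=` C) -> rip (B :: s).

Lemma rip_last s : rip s -> last fset0 s \in s.
Proof. by case=> [B|B C s' _ _ _] /=; rewrite ?mem_head ?mem_last. Qed.

Lemma rip_inv B s : rip (B :: s) -> s = [::] \/
  exists C, [/\ rip s, C \in s & forall A, A \in s -> A `&` B `<=` C].
Proof. by move=> h; inversion h as [|? C]; [left | right; exists C]. Qed.

(** The root of [s1] becomes a child of the root of [s2]. Whatever another bag of [s1] shares with
    [s2] lies in the root of [s1], hence in the parent of that bag. *)
Lemma rip_cat s1 s2 : rip s1 -> rip s2 ->
  (forall A1 A2, A1 \in s1 -> A2 \in s2 ->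
     A1 `&` A2 `<=` last fset0 s1 `&` last fset0 s2) ->
  rip (s1 ++ s2).
Proof.
move=> h1 h2; elim: h1 => {s1} [B|B C s hs IH Cs CB] /= hB.
  apply: (rip_cons h2 (C := last fset0 s2)).
    exact: rip_last.
  by move=> A As; rewrite fsetIC; apply: fsubset_trans (hB _ _ (mem_head _ _) As) _; apply: fsubsetIr.
have lE : last B s = last fset0 s by case: {+}hs.
rewrite lE in hB; apply: (rip_cons _ (C := C)).
- by apply: IH => A1 A2 A1s; apply: hB; rewrite inE A1s orbT.
- by rewrite mem_cat Cs.
move=> A; rewrite mem_cat => /orP[/CB //|As2].
have AB : A `&` B `<=` last fset0 s.
  by rewrite fsetIC; apply: fsubset_trans (hB _ _ (mem_head _ _) As2) _; apply: fsubsetIl.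
apply: fsubset_trans (CB _ (rip_last hs)); rewrite fsubsetI AB; exact: fsubsetIr.
Qed.

Definition fimage (f : nat -> nat) (A : {fset nat}) : {fset nat} := f @` A.

Lemma rip_map (f : nat -> nat) (W : {fset nat}) s : {in W &, injective f} ->
  (forall A, A \in s -> A `<=` W) -> rip s -> rip [seq fimage f A | A <- s].
Proof.
move=> fI sW hs; elim: hs sW => {s} [B|B C s hs IH Cs CB] sW /=; first exact: rip_one.
apply: (rip_cons _ (C := fimage f C)).
- by apply: IH => A As; apply: sW; rewrite inE As orbT.
- exact: map_f.
move=> _ /mapP[A As ->]; apply/fsubsetP => x.
rewrite in_fsetI => /andP[/imfsetP[y /= yA ->] /imfsetP[z /= zB yz]].
have yW : y \in W by apply: (fsubsetP (sW _ _) _ yA); rewrite inE As orbT.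
have zW : z \in W by apply: (fsubsetP (sW _ _) _ zB); rewrite inE eqxx.
rewrite in_imfset //; apply: (fsubsetP (CB A As)).
by rewrite in_fsetI yA (fI _ _ yW zW yz).
Qed.

Lemma rip_nth s i : rip s -> i.+1 < size s ->
  exists j, [/\ i < j, j < size s & forall l, i < l -> l < size s ->
    nth fset0 s l `&` nth fset0 s i `<=` nth fset0 s j].
Proof.
move=> hs; elim: hs i => {s} [B|B C s hs IH Cs CB] [|i] //= hi.
  exists (index C s).+1; split=> //=; first by rewrite ltnS index_mem.
  by move=> [|l] //= _ ls; rewrite nth_index //; apply/CB/mem_nth.
have [j [ij js jP]] := IH i hi; exists j.+1; split=> // -[|l] //; exact: jP.
Qed.

(** The rank decreases towards the root, which gives connectedness. On a cycle, a node of maximal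
    rank can only be adjacent to its parent, while a cycle of length above 2 gives it two distinct
    neighbours. *)
Lemma parent_tree (T : finType) (root : T) (p : T -> T) (rank : T -> nat) :
  (forall x, x != root -> rank (p x) < rank x) -> p root = root ->
  is_tree [rel x y | (x != y) && ((p x == y) || (p y == x))].
Proof.
move=> rk pr; set e := [rel x y | _].
have eS : symmetric e by move=> x y; rewrite /= eq_sym orbC.
split=> //.
- by apply/card_gt0P; exists root.
- by move=> x; rewrite /= eqxx.
- have to_root x : connect e x root.
    have [n] := ubnP (rank x); elim: n x => // n IH x; rewrite ltnS => xn.
    case: (eqVneq x root) => [->|xr]; first exact: connect0.
    apply: connect_trans (connect1 _) (IH (p x) _); last exact: leq_trans (rk _ xr) xn.
    rewrite /= eqxx andbT; apply: contraTneq (rk _ xr) => <-; by rewrite ltnn.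
  by move=> t t'; apply: connect_trans (to_root t) _; rewrite (sym_connect_sym eS).
move=> c c2 /andP[cyc unq].
have [x0 x0c] : exists x0, x0 \in c by case: c c2 {cyc unq} => // x0 c; exists x0; rewrite mem_head.
have [x xc x_max] : exists2 x, x \in c & forall y, y \in c -> rank y <= rank x.
  by case: (arg_maxnP rank x0c) => x xc x_max; exists x.
have nbr y : y \in c -> e x y -> y = p x.
  move=> yc /andP[xy /orP[/eqP //|/eqP py]]; have := x_max y yc.
  rewrite leqNgt -py rk //; apply: contraNneq xy => yr.
  by rewrite -py yr pr.
(* Once the cycle is rotated to start at [x], its second and its last entry both equal [p x],
   against uniqueness. *)
have [i c' rotE] := rot_to xc.
move: cyc unq c2; rewrite -(rot_cycle i) -(rot_uniq i) -(size_rot i) rotE.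
have mem_c y : y \in c' -> y \in c by move=> yc; rewrite -(mem_rot i) rotE inE yc orbT.
case: c' {rotE} mem_c => [|y [|z c']] // mem_c /= /andP[xy].
rewrite rcons_path => /andP[_ /andP[_ lx]] /andP[_ /andP[ynz _]] _; move/negP: ynz; apply.
have -> : y = p x by apply: nbr; rewrite ?mem_c ?mem_head.
suff <- : last z c' = p x by exact: mem_last.
apply: nbr; last exact: etrans (eS _ _) lx.
by apply: mem_c; rewrite inE mem_last orbT.
Qed.

(** This is a tree decomposition of width at most [k] in list form, for which gluing at a join
    becomes concatenation. *)
Record bag_list (k : nat) (G : graph) (s : seq {fset nat}) : Prop := BagList {
  bag_list_rip : rip s;
  bag_list_sub A : A \in s -> A `<=` verts G;
  bag_list_card A : A \in s -> #|` A| <= k.+1;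
  bag_list_vert v : v \in verts G -> exists2 A, A \in s & v \in A;
  bag_list_edge e : e \in edges G ->
    exists2 A, A \in s & forall v, (e, v) \in inc G -> v \in A
}.

Lemma bag_list_isomorphic k G H s : isomorphic G H -> bag_list k G s ->
  exists s', bag_list k H s'.
Proof.
case=> f [g [fI fE gI gE incE]] [hs sG sk sv se].
exists [seq fimage f A | A <- s]; split.
- exact: rip_map fI sG hs.
- by move=> _ /mapP[A /sG AG ->]; rewrite -fE; apply: subset_imfset; apply/fsubsetP.
- move=> _ /mapP[A As ->]; apply: leq_trans (sk _ As); exact: leq_imfset_card.
- rewrite -fE => _ /imfsetP[v /= /sv[A As vA] ->]; exists (fimage f A); first exact: map_f.
  by rewrite in_imfset.
rewrite -gE => _ /imfsetP[e /= eG ->]; have [A As eA] := se e eG.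
exists (fimage f A); first exact: map_f.
move=> w ew; have [_] := inc_sub ew; rewrite -fE => /imfsetP[v /= vG wE].
by rewrite wE in_imfset // eA // incE // -wE.
Qed.

Lemma bag_list_treewidth k G s : bag_list k G s -> treewidth_at_most k G.
Proof.
case=> hs sG sk sv se.
case Es: (size s) => [|m]; first by case: hs Es.
pose b (i : 'I_m.+1) := nth fset0 s i.
have b_in i : b i \in s by rewrite mem_nth // Es.
have in_b A : A \in s -> exists i, A = b i.
  move=> As; have lt : index A s < m.+1 by rewrite -Es index_mem.
  by exists (Ordinal lt); rewrite /b /= nth_index.
(* The last position is the root and its own parent; any other position gets the later one provided
   by [rip_nth]. *)
pose Q (i j : 'I_m.+1) := if i == ord_max then j = i else
  i < j /\ forall l : 'I_m.+1, i < l -> b l `&` b i `<=` b j.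
have [|p pP] := @fin_all_exists _ _ Q.
  move=> i; rewrite /Q; case: eqP => [_|/eqP im]; first by exists i.
  have im' : i.+1 < size s.
    by rewrite Es ltnS ltn_neqAle -ltnS ltn_ord andbT.
  have [j [ij js jP]] := rip_nth hs im'; rewrite Es in js.
  by exists (Ordinal js); split=> // l il; apply: jP; rewrite ?Es.
have p_max : p ord_max = ord_max by have := pP ord_max; rewrite /Q eqxx.
have p_lt i : i != ord_max -> i < p i.
  by move=> im; have := pP i; rewrite /Q (negbTE im) => -[].
have p_bag (i l : 'I_m.+1) : i < l -> b l `&` b i `<=` b (p i).
  move=> il; have := pP i; rewrite /Q; case: eqP => [im|_ [_]]; last exact.
  by move: il; rewrite im ltnNge -ltnS ltn_ord.
have tree : is_tree [rel x y | (x != y) && ((p x == y) || (p y == x))].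
  apply: (@parent_tree _ ord_max p (fun i => m - i)) => // i /p_lt ip.
  have := ltn_ord (p i); lia.
have conn v (t t' : 'I_m.+1) : v \in b t -> v \in b t' -> connect
    [rel x y | [&& [rel x y | (x != y) && ((p x == y) || (p y == x))] x y, v \in b x & v \in b y]] t t'.
  set e := [rel x y | _] => vt.
  have eS : symmetric e.
    by move=> x y; rewrite /e /= eq_sym orbC; congr (_ && _); rewrite andbC.
  (* [i0] is the last bag that contains [v]. An earlier bag with [v] shares it with [b i0], so its
     parent contains [v] too, and climbing parents ends at [i0]. *)
  have [i0 vi0 i0_max] : exists2 i0 : 'I_m.+1, v \in b i0 & forall i : 'I_m.+1, v \in b i -> i <= i0.
    by case: (@arg_maxnP _ t (fun i => v \in b i) (fun i => i : nat) vt) => i0 vi0 i0_max; exists i0.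
  have up i : v \in b i -> connect e i i0.
    have [n] := ubnP (i0 - i); elim: n i => // n IH i; rewrite ltnS => i_n vi.
    have := i0_max i vi; rewrite leq_eqVlt => /orP[/eqP/val_inj ->|ii0]; first exact: connect0.
    have im : i != ord_max.
      by apply: contraTneq ii0 => ->; rewrite -leqNgt -ltnS ltn_ord.
    have vp : v \in b (p i) by apply: (fsubsetP (p_bag _ _ ii0)); rewrite in_fsetI vi0.
    apply: connect_trans (connect1 _) (IH (p i) _ vp).
      rewrite /e /= vi vp eqxx !andbT; have := p_lt i im.
      by case: eqP => // <-; rewrite ltnn.
    have := p_lt i im; have := i0_max _ vp; lia.
  by move=> vt'; apply: connect_trans (up _ vt) _; rewrite (sym_connect_sym eS) up.
have bagG i : b i `<=` verts G by exact: sG.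
have vertG v : v \in verts G -> exists t, v \in b t.
  by move=> /sv[A /in_b[i ->] vA]; exists i.
have edgeG e : e \in edges G -> exists t, forall v, (e, v) \in inc G -> v \in b t.
  by move=> /se[A /in_b[i ->] eA]; exists i.
exists (TreeDecomposition tree bagG vertG edgeG conn).
rewrite /width -subn1 leq_subLR add1n.
by apply/bigmax_leqP => i _; exact: sk (b_in i).
Qed.

(** * Listing the nodes of a tree by growing a connected subtree *)

Section TreeOrder.
Variables (T : finType) (adj : rel T) (bag : T -> {fset nat}).
Hypotheses (tree : is_tree adj)
  (conn : forall v t t', v \in bag t -> v \in bag t' ->
    connect [rel x y | [&& adj x y, v \in bag x & v \in bag y]] t t').

Lemma path_exit (s : seq T) x p : path adj x p -> x \in s -> last x p \notin s ->
  exists q l, [/\ q \in s, l \notin s & adj q l].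
Proof.
elim: p x => [|y p IH] x /=; first by move=> _ ->.
case/andP=> xy yp xs lp; case: (boolP (y \in s)) => [ys|yN]; first exact: IH yp ys lp.
by exists x, y.
Qed.

Let within (s : seq T) := [rel x y | [&& adj x y, x \in s & y \in s]].

Lemma path_within (s p : seq T) x : path (within s) x p -> {subset p <= s}.
Proof.
elim: p x => // y p IH x /= /andP[/and3P[_ _ ys] yp] z.
by rewrite inE => /orP[/eqP -> //|]; apply: IH yp z.
Qed.

(* Otherwise a path of bags containing v from l to the nodes of s closes to a
   cycle through q. *)
Lemma attach_bag (s : seq T) q l v t :
  (forall x y, x \in s -> y \in s -> connect (within s) x y) ->
  q \in s -> l \notin s -> adj q l ->
  t \in s -> v \in bag t -> v \in bag l -> v \in bag q.
Proof.
move=> sc qs lN ql ts vt vl; have /connectP[p0 p0P tE] := conn vl vt.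
case: tE => tE; move: ts; rewrite tE => {tE t vt}.
case: (shortenP p0P) => p pP p_uniq _ {p0 p0P} ps.
have hasp : has (mem s) p.
  case: p ps {pP p_uniq} => [|y p] /=; first by rewrite (negbTE lN).
  by move=> ps; rewrite -[_ || _]/(has (mem s) (y :: p)); apply/hasP; exists (last y p); rewrite ?mem_last.
(* The path is cut at its first node [j] in [s]. Unless [j] is [q], a path inside [s] from [j] to
   [q] and the edge from [q] to [l] close a simple cycle. *)
move: pP p_uniq {ps}; case/split_find: hasp => j p1 p2 /= js p1N.
rewrite cat_path => /andP[pj _] /= /andP[lp].
rewrite cat_uniq => /andP[p1_uniq _].
have vj : v \in bag j.
  by move: pj; rewrite rcons_path => /andP[_ /and3P[]].
case: (eqVneq j q) => [<- //|jq].
have /connectP[p3' p3'P qE] := sc _ _ js qs.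
move: qE; case: (shortenP p3'P) => p3 p3P p3_uniq _ {p3' p3'P} qE.
have p3s : {subset p3 <= s} := path_within p3P.
case: tree => _ _ _ _ /(_ (l :: rcons p1 j ++ p3)); case.
  rewrite /= size_cat size_rcons; case: p3 qE {p3P p3_uniq p3s} => [/= qE|y p3 _ /=]; last lia.
  by rewrite qE eqxx in jq.
have sub : subrel (within s) adj by move=> x y /and3P[].
apply/andP; split.
  rewrite /= rcons_path cat_path last_cat last_rcons -qE ql andbT.
  rewrite (sub_path _ pj) /=; last by move=> x y /and3P[].
  exact: sub_path sub _ _ p3P.
rewrite /= cat_uniq p1_uniq mem_cat negb_or (contra (p3s l) lN) andbT /=.
move: lp; rewrite mem_cat negb_or => /andP[-> _] /=.
case/andP: p3_uniq => jp3 p3u; apply/andP; split; last exact: p3u.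
apply/hasPn => x xp3 /=.
rewrite mem_rcons inE negb_or; apply/andP; split; first by apply: contraNneq jp3 => <-.
by apply: contra p1N => xp1; apply/hasP; exists x => //; apply: p3s.
Qed.

(** Connectedness of the listed nodes within the list is part of the induction, because [attach_bag]
    needs it to make [q] a valid parent of the new node. *)
Lemma tree_rip : exists s : seq T, [/\ uniq s, forall t, t \in s & rip (map bag s)].
Proof.
case: (tree) => T0 adjS _ adjC _.
suff [s [s_uniq sT hs _]] : exists s : seq T, [/\ uniq s, size s = #|T|, rip (map bag s) &
    forall x y, x \in s -> y \in s -> connect (within s) x y].
  exists s; split=> // t.
  have sub : {subset s <= enum T} by move=> x _; rewrite mem_enum.
  by have [|_ ->] := uniq_min_size s_uniq sub; rewrite ?mem_enum // sT -cardE.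
suff gen n : 0 < n <= #|T| -> exists s : seq T, [/\ uniq s, size s = n, rip (map bag s) &
    forall x y, x \in s -> y \in s -> connect (within s) x y] by apply: gen; rewrite T0 /=.
elim: n => // -[_ _|n IH nT].
  case/card_gt0P: T0 => t _; exists [:: t]; split=> //; first exact: rip_one.
  by move=> x y; rewrite !inE => /eqP -> /eqP ->; apply: connect0.
have [|s [s_uniq ss hs sc]] := IH; first by rewrite /= ltnW.
have [x xs] : exists x, x \in s by case: (s) ss => // x s' _; exists x; rewrite mem_head.
have [y yN] : exists y, y \notin s.
  apply/existsP; rewrite -negb_forall; apply: contraL nT => /forallP sT; rewrite -ltnNge ltnS -ss.
  rewrite cardE; apply: uniq_leq_size; rewrite ?enum_uniq // => z _.
have /connectP[p pP yE] := adjC x y.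
have [|q [l [qs lN ql]]] := path_exit pP xs; first by rewrite -yE.
exists (l :: s); split; rewrite /= ?lN ?ss //.
  apply: (rip_cons hs (map_f bag qs)) => _ /mapP[t ts ->]; apply/fsubsetP => v.
  by rewrite in_fsetI => /andP[]; apply: attach_bag sc qs lN ql ts.
have sub : subrel (connect (within s)) (connect (within (l :: s))).
  apply: connect_sub => a b /and3P[ab as_ bs]; apply: connect1.
  by rewrite /= ab !inE as_ bs !orbT.
have wS : symmetric (within (l :: s)).
  by move=> a b; rewrite /= adjS; congr (_ && _); rewrite andbC.
have toq a : a \in l :: s -> connect (within (l :: s)) a q.
  rewrite inE => /orP[/eqP ->|as_]; last by apply/sub/sc.
  by apply: connect1; rewrite /= adjS ql !inE eqxx qs orbT.
by move=> a b /toq aq /toq; rewrite (sym_connect_sym wS); apply: connect_trans.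
Qed.
End TreeOrder.

(** * From terms to bags *)

Section ActiveVertices.
Variable k : nat.
Implicit Types (G : lgraph k) (t : term k).

Definition active G : {fset nat} := [fset x in verts G | [exists u, lab G u == Some x]].

Lemma activeP G x : reflect (exists u, lab G u = Some x) (x \in active G).
Proof.
rewrite !inE; apply: (iffP andP) => [[_ /existsP[u /eqP ux]]|[u ux]]; first by exists u.
by rewrite (lab_in ux); split=> //; apply/existsP; exists u; apply/eqP.
Qed.

Lemma card_active G : #|` active G| <= k.+1.
Proof.
pose h u := odflt 0 (lab G u).
rewrite -[k.+1]card_ord cardE -(size_map h); apply: uniq_leq_size; first exact: fset_uniq.
move=> x /activeP[u ux]; apply/mapP; exists u; first by rewrite mem_enum.
by rewrite /h ux.
Qed.

(** The induction keeps all active vertices in the root bag. New edges then fit into the root,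
    forgetting needs no new bag, and a join attaches one root to the other because shared vertices
    are active. *)
Lemma term_bag_list t B : reaches t B ->
  exists2 s, bag_list k (graph_of t) s & active (graph_of t) `<=` last fset0 s.
Proof.
elim=> {t B} [|u t B tB [s [hs sG sk sv se] sa] uB|u t B tB [s hs sa] uB
  |u v uv t B tB [s [hs sG sk sv se] sa] uB vB|t1 t2 B tB1 [s1 hs1 sa1] tB2 [s2 hs2 sa2]].
- exists [:: fset0]; last by apply/fsubsetP => x /activeP[].
  by split=> //; [exact: rip_one|move=> A|move=> A]; rewrite inE => /eqP ->.
(* The new active set becomes the root. Apart from the fresh vertex it lies in the old root, so it
   meets the old bags only there. *)
- set G := graph_of t; set A := active (intro_vertex u G).
  have AG : A `<=` verts (intro_vertex u G) by exact: fset_sub.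
  have hA A1 : A1 \in s -> A1 `&` A `<=` last fset0 s.
    move=> A1s; apply/fsubsetP => x; rewrite in_fsetI => /andP[/(fsubsetP (sG _ A1s)) xG].
    case/activeP => l /=; case: eqP => [_ [xE]|_ lx].
      by move: xG; rewrite -xE (negbTE (freshP _)).
    by apply: (fsubsetP sa); apply/activeP; exists l.
  exists (s ++ [:: A]); last by rewrite last_cat.
  split.
  + apply: rip_cat => //; first exact: rip_one.
    move=> A1 A2 A1s; rewrite inE => /eqP -> /=; rewrite fsubsetI hA //; exact: fsubsetIr.
  + move=> A1; rewrite mem_cat inE => /orP[/sG A1G|/eqP -> //].
    by apply: fsubset_trans A1G _; apply: fsubsetU1.
  + by move=> A1; rewrite mem_cat inE => /orP[/sk //|/eqP ->]; apply: card_active.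
  + move=> x; rewrite in_fset1U => /orP[/eqP ->|/sv[A1 A1s xA]].
      exists A; first by rewrite mem_cat mem_head orbT.
      by apply/activeP; exists u; rewrite /= eqxx.
    by exists A1; rewrite ?mem_cat ?A1s.
  by move=> e /se[A1 A1s eA]; exists A1; rewrite ?mem_cat ?A1s.
- exists s; first exact: hs.
  apply: fsubset_trans sa; apply/fsubsetP => x /activeP[l /=].
  by case: eqP => // _ lx; apply/activeP; exists l.
- have ls := rip_last hs.
  exists s; last by apply: fsubset_trans sa; apply/fsubsetP => x /activeP[l lx]; apply/activeP; exists l.
  split=> // e; rewrite /= /new_edges /new_inc.
  case Eu: (lab _ u) => [x|] /=; last exact: se.
  case Ev: (lab _ v) => [y|] /=; last exact: se.
  rewrite in_fset1U => /orP[/eqP ->|eG].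
    exists (last fset0 s) => // z; rewrite !inE !xpair_eqE eqxx /=.
    have -> /= : ((fresh (edges (graph_of t)), z) \in inc (graph_of t)) = false.
      by apply/negP => /inc_sub[]; rewrite (negbTE (freshP _)).
    by rewrite orbF => /orP[]/eqP ->; apply: (fsubsetP sa); apply/activeP; [exists u | exists v].
  have [A As eA] := se e eG; exists A => // z; rewrite !inE !xpair_eqE.
  suff -> : (e == fresh (edges (graph_of t))) = false by apply: eA.
  by apply: contraTF eG => /eqP ->; apply: freshP.
set G1 := graph_of t1 in hs1 sa1 *; set G2 := graph_of t2 in hs2 sa2 *.
have lab12 : lab_set G1 = lab_set G2.
  by rewrite (reaches_lab_set tB1) (reaches_lab_set tB2).
case: hs1 hs2 => [hs1 sG1 sk1 sv1 se1] [hs2 sG2 sk2 sv2 se2].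
have lastE f s : last fset0 (map (fimage f) s) = fimage f (last fset0 s).
  by rewrite -(last_map (fimage f)) /fimage imfset0.
pose g := glue G1 G2; have g_inj : injective g := @glue_inj _ G1 G2.
have mem1 (A : {fset nat}) x : x \in A -> x.*2 \in fimage double A by move=> xA; rewrite in_imfset.
have mem2 (A : {fset nat}) x : x \in A -> g x \in fimage g A by move=> xA; rewrite in_imfset.
exists (map (fimage double) s1 ++ map (fimage g) s2).
  split.
  - apply: rip_cat.
    + by apply: (rip_map _ sG1) => // x y _ _; apply: double_inj.
    + by apply: (rip_map _ sG2) => // x y _ _; apply: g_inj.
    move=> _ _ /mapP[A1 A1s ->] /mapP[A2 A2s ->]; rewrite !lastE; apply/fsubsetP => z.
    rewrite in_fsetI => /andP[/imfsetP[x /= xA ->] /imfsetP[y /= yA /esym xy]].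
    have [u ux uy] := glue_eq_double lab12 xy.
    rewrite in_fsetI mem1; last by apply: (fsubsetP sa1); apply/activeP; exists u.
    by rewrite -xy mem2 //; apply: (fsubsetP sa2); apply/activeP; exists u.
  - move=> A; rewrite mem_cat => /orP[]/mapP[A' A's ->]; apply/fsubsetP => _ /imfsetP[x /= xA ->];
      rewrite in_fsetU; apply/orP; [left|right]; apply/imfsetP; exists x => //.
      exact: (fsubsetP (sG1 _ A's)).
    exact: (fsubsetP (sG2 _ A's)).
  - move=> A; rewrite mem_cat => /orP[]/mapP[A' A's ->].
      by apply: leq_trans (sk1 _ A's); apply: leq_imfset_card.
    by apply: leq_trans (sk2 _ A's); apply: leq_imfset_card.
  - move=> z; rewrite in_fsetU => /orP[]/imfsetP[x /= xG ->].
      have [A As xA] := sv1 x xG; exists (fimage double A); last exact: mem1.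
      by rewrite mem_cat map_f.
    have [A As xA] := sv2 x xG; exists (fimage g A); last exact: mem2.
    by rewrite mem_cat (map_f (fimage g)) ?orbT.
  move=> e; rewrite in_fsetU => /orP[]/imfsetP[d /= dG ->].
    have [A As dA] := se1 d dG; exists (fimage double A); first by rewrite mem_cat map_f.
    move=> z; rewrite in_fsetU => /orP[]/imfsetP[[d' x] /= dx [dE ->]].
      by apply/mem1/dA; rewrite (double_inj dE).
    by move/eqP: dE; rewrite double_neq_doubleS.
  have [A As dA] := se2 d dG; exists (fimage g A); first by rewrite mem_cat (map_f (fimage g)) ?orbT.
  move=> z; rewrite in_fsetU => /orP[]/imfsetP[[d' x] /= dx [dE ->]].
    by move/esym/eqP: dE; rewrite double_neq_doubleS.
  by apply/mem2/dA; rewrite (double_inj dE).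
rewrite last_cat; have -> : last (last fset0 (map (fimage double) s1)) (map (fimage g) s2) = fimage g (last fset0 s2).
  by rewrite -lastE; case: {+}hs2.
apply/fsubsetP => z /activeP[u /=].
have : (u \in lab_set G1) = (u \in lab_set G2) by rewrite lab12.
rewrite !inE; case ux: (lab G1 u) => [x|] //=; case uy: (lab G2 u) => [y|] // _ [<-].
by rewrite -(glue_lab ux uy) mem2 //; apply: (fsubsetP sa2); apply/activeP; exists u.
Qed.
End ActiveVertices.

Lemma extend_coloring k (A B : {fset nat}) (c : nat -> 'I_k.+1) :
  A `<=` B -> #|` B| <= k.+1 -> {in A &, injective c} ->
  exists c' : nat -> 'I_k.+1, {in B &, injective c'} /\
    forall x, x \notin B `\` A -> c' x = c x.
Proof.
have [n] := ubnP #|` B `\` A|; elim: n A c => // n IH A c; rewrite ltnS => An AB Bk cI.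
case: (fset_0Vmem (B `\` A)) => [BA|[x xBA]].
  have BA' x : x \in B -> x \in A.
    by move=> xB; apply: contraFT (in_fset0 x) => xA; rewrite -BA in_fsetD xA.
  by exists c; split=> // x y /BA' xA /BA' yA; apply: cI.
have := xBA; rewrite in_fsetD => /andP[xA xB].
have xAB : x |` A `<=` B by rewrite fsubUset fsub1set xB.
have [u uN] : exists u, u \notin c @` A.
  apply/existsP; rewrite -negb_forall; apply/negP => /forallP h.
  have le1 : k.+1 <= #|` c @` A|.
    rewrite -[leqLHS]card_ord cardE; apply: uniq_leq_size; first exact: enum_uniq.
    by move=> u _; apply: h.
  have le2 : #|` c @` A| <= #|` A| by exact: leq_imfset_card.
  have ltA : #|` A| < #|` B| by apply: leq_trans (fsubset_leq_card xAB); rewrite cardfsU1 xA.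
  by have := leq_trans (leq_trans ltA Bk) (leq_trans le1 le2); rewrite ltnn.
pose c1 y := if y == x then u else c y.
have c1A y : y \in A -> c1 y = c y.
  by move=> yA; rewrite /c1; case: eqP => // yx; rewrite -yx yA in xA.
have c1x : c1 x = u by rewrite /c1 eqxx.
have cu y : y \in A -> c y != u.
  by move=> yA; apply: contraNneq uN => <-; rewrite in_imfset.
have [||//|y z|c' [c'I c'E]] := IH (x |` A) c1.
- have -> : B `\` (x |` A) = (B `\` A) `\ x by rewrite fsetDDl fsetUC.
  by move: An; rewrite (cardfsD1 x (B `\` A)) xBA.
- done.
- rewrite !inE => /orP[/eqP ->|yA] /orP[/eqP ->|zA] //; rewrite ?c1x ?c1A //.
  + by move/esym/eqP; rewrite (negbTE (cu _ zA)).
  + by move/eqP; rewrite (negbTE (cu _ yA)).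
  exact: cI.
exists c'; split=> // y yBA; rewrite c'E; last first.
  by apply: contra yBA; rewrite !inE negb_or => /andP[/andP[_ ->]].
by rewrite /c1; case: eqP => // yx; rewrite yx xBA in yBA.
Qed.

Lemma rip_coloring k s : rip s -> (forall A, A \in s -> #|` A| <= k.+1) ->
  exists c : nat -> 'I_k.+1, forall A, A \in s -> {in A &, injective c}.
Proof.
move=> hs; elim: hs => {s} [B|B C s hs IH Cs CB] sk.
  have [||//|c [cI _]] := @extend_coloring k fset0 B (fun=> ord0).
  - exact: fsub0set.
  - by apply: sk; rewrite inE.
  by exists c => A; rewrite inE => /eqP ->.
have [A As|c cI] := IH; first by apply: sk; rewrite inE As orbT.
(* The vertices of [B] that already have a colour all lie in its parent [C], where [c] is
   injective. *)
pose D := [fset x in B | has (fun A : {fset nat} => x \in A) s].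
have DC : D `<=` C.
  apply/fsubsetP => x; rewrite !inE => /andP[xB /hasP[A As xA]].
  by apply: (fsubsetP (CB A As)); rewrite in_fsetI xA.
have [||x y xD yD|c' [c'I c'E]] := @extend_coloring k D B c.
- exact: fset_sub.
- by apply: sk; rewrite mem_head.
- by apply: (cI C Cs); apply: (fsubsetP DC).
exists c' => A; rewrite inE => /orP[/eqP -> //|As] x y xA yA.
have c'A z : z \in A -> c' z = c z.
  move=> zA; apply: c'E; rewrite !inE negb_and negbK.
  by case: (z \in B); rewrite ?orbT //=; apply/orP; left; apply/hasP; exists A.
by rewrite !c'A //; apply: (cI A As).
Qed.

(** * From bags to terms *)

Section Build.
Variables (k : nat) (H : graph) (c : nat -> 'I_k.+1).

(* [build V E B]: the subgraph of H with vertices V and edges E is the value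
   of a term whose active vertices are B, each x in B being labelled c x. *)
Inductive build : {fset nat} -> {fset nat} -> {fset nat} -> Prop :=
  | build_empty : build fset0 fset0 fset0
  | build_vertex x V E B : build V E B -> x \in verts H -> x \notin V ->
      (forall y, y \in B -> c y != c x) -> build (x |` V) E (x |` B)
  | build_forget x V E B : build V E B -> x \in B -> build V E (B `\ x)
  | build_edge e V E B : build V E B -> e \in edges H -> e \notin E ->
      (forall v, (e, v) \in inc H -> v \in B) -> build V (e |` E) B
  | build_join V1 V2 E1 E2 B : build V1 E1 B -> build V2 E2 B ->
      V1 `&` V2 `<=` B -> (forall e, e \in E1 -> e \notin E2) ->
      build (V1 `|` V2) (E1 `|` E2) B.

Lemma build_sub V E B : build V E B ->
  [/\ B `<=` V, V `<=` verts H, E `<=` edges H &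
      forall e v, e \in E -> (e, v) \in inc H -> v \in V].
Proof.
elim=> {V E B} [|x V E B _ [BV VH EH inV] xH _ _|x V E B _ [BV VH EH inV] _
  |e V E B _ [BV VH EH inV] eH _ eB|V1 V2 E1 E2 B _ [BV1 VH1 EH1 inV1] _ [BV2 VH2 EH2 inV2] _ _].
- by split; rewrite ?fsub0set.
- split=> //; first exact: fsetUS.
    by rewrite fsubUset fsub1set xH.
  by move=> e v eE /(inV _ _ eE) vV; rewrite in_fset1U vV orbT.
- split=> //; apply: fsubset_trans BV; exact: fsubD1set.
- split=> //; first by rewrite fsubUset fsub1set eH.
  move=> d v; rewrite in_fset1U => /orP[/eqP -> /eB /(fsubsetP BV) //|]; exact: inV.
split; rewrite ?fsubUset ?VH1 ?EH1 //; first by apply: fsubset_trans BV1 _; apply: fsubsetUl.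
by move=> e v; rewrite !in_fsetU => /orP[eE /(inV1 _ _ eE) ->|eE /(inV2 _ _ eE) ->]; rewrite ?orbT.
Qed.

Lemma build_inj V E B : build V E B -> {in B &, injective c}.
Proof.
elim=> {V E B} [|x V E B _ cI _ _ xB|x V E B _ cI _|//|//] //.
  move=> y z; rewrite !in_fset1U => /orP[/eqP ->|yB] /orP[/eqP ->|zB] //; last exact: cI.
    by move/esym/eqP; rewrite (negbTE (xB _ zB)).
  by move/eqP; rewrite (negbTE (xB _ yB)).
by move=> y z; rewrite !in_fsetD1 => /andP[_ yB] /andP[_ zB]; apply: cI.
Qed.

(** An isomorphism onto a subgraph of [H] that also matches labels with colours. [V] and [E] stay
    plain sets, so the subgraph need not be packed as a [graph]. *)
Record realizes (G : lgraph k) (V E B : {fset nat}) (f g : nat -> nat) : Prop := Realizes {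
  realizes_finj : {in verts G &, injective f};
  realizes_fim : f @` verts G = V;
  realizes_ginj : {in edges G &, injective g};
  realizes_gim : g @` edges G = E;
  realizes_inc e v : e \in edges G -> v \in verts G ->
    ((e, v) \in inc G) = ((g e, f v) \in inc H);
  realizes_lab u x : lab G u = Some x -> f x \in B /\ c (f x) = u;
  realizes_act y : y \in B -> exists2 x, lab G (c y) = Some x & f x = y
}.

Lemma realizes_vertex G V E B f g x : build V E B -> realizes G V E B f g ->
  x \notin V -> (forall y, y \in B -> c y != c x) ->
  realizes (intro_vertex (c x) G) (x |` V) E (x |` B)
    (fun z => if z == fresh (verts G) then x else f z) g.
Proof.
move=> bu [fI fE gI gE incE labB actB] xV xB.
have [BV _ _ inV] := build_sub bu.
set n := fresh (verts G); set f' := fun z => _.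
have f'n : f' n = x by rewrite /f' eqxx.
have nG : n \notin verts G := freshP _.
have f'G z : z \in verts G -> f' z = f z.
  by move=> zG; rewrite /f'; case: eqP => // zn; rewrite -zn zG in nG.
have fx z : z \in verts G -> f z != x.
  by move=> zG; apply: contraNneq xV => <-; rewrite -fE in_imfset.
have labG u z : lab G u = Some z -> f' z = f z by move/lab_in/f'G.
split=> //.
- move=> y z; rewrite /= !in_fset1U => /orP[/eqP ->|yG] /orP[/eqP ->|zG] //; rewrite ?f'n ?f'G //.
  + by move/esym/eqP; rewrite (negbTE (fx _ zG)).
  + by move/eqP; rewrite (negbTE (fx _ yG)).
  exact: fI.
- apply/fsetP => z; rewrite in_fset1U -fE; apply/imfsetP/orP.
    case=> y /=; rewrite in_fset1U => /orP[/eqP -> ->|yG ->]; first by left; rewrite f'n.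
    by right; rewrite f'G // in_imfset.
  case=> [/eqP ->|/imfsetP[y /= yG ->]]; first by exists n; rewrite ?f'n //= in_fset1U eqxx.
  by exists y; rewrite ?f'G //= in_fset1U yG orbT.
- move=> e v eG; rewrite /= in_fset1U => /orP[/eqP ->|vG]; last by rewrite f'G // incE.
  rewrite f'n; have -> : ((e, n) \in inc G) = false.
    by apply/negP => /inc_sub[_]; rewrite (negbTE nG).
  (* Edges of [E] have their endpoints in [V], so none of them meets the new vertex. *)
  apply/esym/negP => /inV h; move/negP: xV; apply; apply: h.
  by rewrite -gE in_imfset.
- move=> u z /=; case: eqP => [-> [<-]|_ uz].
    by rewrite f'n in_fset1U eqxx.
  by have [fzB cE] := labB _ _ uz; rewrite (labG _ _ uz) in_fset1U fzB orbT.
move=> y; rewrite in_fset1U => /orP[/eqP ->|yB]; first by exists n => //=; rewrite eqxx.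
have [z yz fz] := actB y yB; exists z; last by rewrite (labG _ _ yz).
by rewrite /= (negbTE (xB _ yB)).
Qed.

Lemma edge_endpoints e : e \in edges H ->
  exists a b, a != b /\ forall v, ((e, v) \in inc H) = (v == a) || (v == b).
Proof.
move=> /edge_ends; set S := [fset _ in _ | _] => S2.
have SE v : ((e, v) \in inc H) = (v \in S).
  by rewrite !inE; apply/idP/andP => [ev|[]//]; case/inc_sub: (ev).
have : uniq (enum_fset S) := fset_uniq S.
have : forall v, (v \in S) = (v \in enum_fset S) by [].
move: S2; case: (enum_fset S) => [|a [|b []]] //= _ mS /andP[ab _].
exists a, b; split; first by rewrite inE in ab.
by move=> v; rewrite SE mS !inE.
Qed.

Lemma realizes_edge G V E B f g e a b (ab : c a != c b) : build V E B -> realizes G V E B f g ->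
  e \notin E -> a \in B -> b \in B ->
  (forall v, ((e, v) \in inc H) = (v == a) || (v == b)) ->
  realizes (intro_edge ab G) V (e |` E) B f
    (fun d => if d == fresh (edges G) then e else g d).
Proof.
move=> bu [fI fE gI gE incE labB actB] eE aB bB eab.
set n := fresh (edges G); set g' := fun d => _.
have g'n : g' n = e by rewrite /g' eqxx.
have nG : n \notin edges G := freshP _.
have g'G d : d \in edges G -> g' d = g d.
  by move=> dG; rewrite /g'; case: eqP => // dn; rewrite -dn dG in nG.
have ge d : d \in edges G -> g d != e.
  by move=> dG; apply: contraNneq eE => <-; rewrite -gE in_imfset.
have [x ax xa] := actB a aB; have [y bY yb] := actB b bB.
split=> //; rewrite /= /new_edges /new_inc ax bY /=.
- move=> i j; rewrite !in_fset1U => /orP[/eqP ->|iG] /orP[/eqP ->|jG] //; rewrite ?g'n ?g'G //.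
  + by move/esym/eqP; rewrite (negbTE (ge _ jG)).
  + by move/eqP; rewrite (negbTE (ge _ iG)).
  exact: gI.
- apply/fsetP => z; rewrite in_fset1U -gE; apply/imfsetP/orP.
    case=> i /=; rewrite in_fset1U => /orP[/eqP -> ->|iG ->]; first by left; rewrite g'n.
    by right; rewrite g'G // in_imfset.
  case=> [/eqP ->|/imfsetP[i /= iG ->]]; first by exists n; rewrite ?g'n //= in_fset1U eqxx.
  by exists i; rewrite ?g'G //= in_fset1U iG orbT.
move=> d v; rewrite !inE !xpair_eqE -/n => /orP[/eqP ->|dG] vG.
  rewrite g'n eqxx /= eab -xa -yb.
  have -> : (((n, v) : nat * nat) \in inc G) = false.
    by apply/negP => /inc_sub[]; rewrite (negbTE nG).
  by rewrite orbF !(inj_in_eq fI) // ?(lab_in ax) ?(lab_in bY).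
rewrite g'G // -incE //; have -> // : (d == n) = false.
by apply: contraTF dG => /eqP ->.
Qed.

Lemma realizes_join G1 G2 V1 V2 E1 E2 B f1 g1 f2 g2 :
  build V1 E1 B -> build V2 E2 B -> V1 `&` V2 `<=` B -> (forall e, e \in E1 -> e \notin E2) ->
  realizes G1 V1 E1 B f1 g1 -> realizes G2 V2 E2 B f2 g2 ->
  exists f g, realizes (join G1 G2) (V1 `|` V2) (E1 `|` E2) B f g.
Proof.
move=> b1 b2 V12 E12 [fI1 fE1 gI1 gE1 incE1 labB1 actB1] [fI2 fE2 gI2 gE2 incE2 labB2 actB2].
have [BV1 _ _ inV1] := build_sub b1; have [BV2 _ _ inV2] := build_sub b2.
have cI := build_inj b1.
have lab12 : lab_set G1 = lab_set G2.
  apply/setP => u; rewrite !inE.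
  case ux: (lab G1 u) => [x|]; case uy: (lab G2 u) => [y|] //=.
    by have [xB xu] := labB1 _ _ ux; have [z] := actB2 _ xB; rewrite xu uy.
  by have [yB yu] := labB2 _ _ uy; have [z] := actB1 _ yB; rewrite yu ux.
(* Parity tells the copies apart, except that a labelled vertex of [G2] has an even code; [fg] holds
   there because both preimages have the same colour and [c] is injective on [B]. *)
pose f z := if odd z then f2 z./2 else f1 z./2.
pose g z := if odd z then g2 z./2 else g1 z./2.
have fd x : f x.*2 = f1 x by rewrite /f odd_double doubleK.
have gd x : g x.*2 = g1 x by rewrite /g odd_double doubleK.
have gs x : g x.*2.+1 = g2 x by rewrite /g /= odd_double /= uphalf_double.
have fg y : f (glue G1 G2 y) = f2 y.
  case: (glueP lab12 y) => [u x ux uy|_]; last by rewrite /f /= odd_double /= uphalf_double.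
  have [xB xu] := labB1 _ _ ux; have [yB yu] := labB2 _ _ uy.
  by rewrite fd; apply: cI; rewrite // xu yu.
(* Equal images lie in [V1] and [V2], hence in [B]; the two vertices then carry the same label and
   are identified. *)
have glued x y : x \in verts G1 -> y \in verts G2 -> f1 x = f2 y -> glue G1 G2 y = x.*2.
  move=> xG yG xy; have fB : f1 x \in B.
    by apply: (fsubsetP V12); rewrite in_fsetI -{1}fE1 in_imfset //= xy -fE2 in_imfset.
  have [x' lx' xx'] := actB1 _ fB; have [y' ly' yy'] := actB2 _ fB.
  have <- : x' = x by apply: fI1; rewrite // (lab_in lx').
  have <- : y' = y by apply: fI2; rewrite ?(lab_in ly') // yy'.
  exact: glue_lab lx' ly'.
have fI : {in verts (join G1 G2) &, injective f}.
  move=> z w; rewrite /= !in_fsetU.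
  case/orP=> /imfsetP[x /= xG ->]; case/orP=> /imfsetP[y /= yG ->]; rewrite ?fd ?fg.
  - by move/fI1 => ->.
  - by move/glued => ->.
  - by move/esym/glued => ->.
  - by move/fI2 => ->.
have v1 x : x \in verts G1 -> x.*2 \in verts (join G1 G2).
  by move=> xG; rewrite /= in_fsetU mem_double_fset xG.
have v2 x : x \in verts G2 -> glue G1 G2 x \in verts (join G1 G2).
  by move=> xG; rewrite /= in_fsetU mem_glue_image xG orbT.
exists f, g; split=> //.
- apply/fsetP => z; rewrite in_fsetU -fE1 -fE2; apply/imfsetP/orP => /=.
    case=> w; rewrite in_fsetU => /orP[]/imfsetP[x /= xG ->] ->; [left|right];
      by rewrite ?fd ?fg in_imfset.
  by case=> /imfsetP[x /= xG ->]; [exists x.*2; rewrite ?fd ?v1|exists (glue G1 G2 x); rewrite ?fg ?v2].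
- have g12 i j : i \in edges G1 -> j \in edges G2 -> g1 i <> g2 j.
    move=> iG jG ij; have := E12 (g1 i); rewrite -gE1 -gE2 in_imfset //= => /(_ isT).
    by rewrite ij in_imfset.
  move=> z w; rewrite /= !in_fsetU.
  case/orP=> /imfsetP[x /= xG ->]; case/orP=> /imfsetP[y /= yG ->]; rewrite ?gd ?gs.
  - by move/gI1 => ->.
  - by move/g12 => h; case: h.
  - by move/esym/g12 => h; case: h.
  - by move/gI2 => ->.
- apply/fsetP => z; rewrite in_fsetU -gE1 -gE2; apply/imfsetP/orP => /=.
    case=> w; rewrite in_fsetU => /orP[]/imfsetP[x /= xG ->] ->; [left|right];
      by rewrite ?gd ?gs in_imfset.
  case=> /imfsetP[x /= xG ->]; [exists x.*2|exists x.*2.+1]; rewrite ?gd ?gs // in_fsetU.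
    by rewrite mem_double_fset xG.
  by rewrite orbC; apply/orP; left; apply/imfsetP; exists x.
- move=> e z; rewrite {1}/join /= [e \in _]in_fsetU => /orP[]/imfsetP[d /= dG ->] zG; rewrite in_fsetU ?gd ?gs.
    apply/orP/idP => [[]/imfsetP[[d' x] /= dx [dd ->]]|dz].
    + by rewrite fd -incE1 // ?(double_inj dd) //; case/inc_sub: dx.
    + by move/eqP: dd; rewrite double_neq_doubleS.
    (* Endpoints of an edge of [E1] lie in [V1], so injectivity of [f] places [z] in the first
       copy. *)
    left; have : f z \in V1 by apply: inV1 dz; rewrite -gE1 in_imfset.
    rewrite -fE1 => /imfsetP[x /= xG]; rewrite -fd => /fI zE.
    apply/imfsetP; exists (d, x); last by rewrite /= -zE ?v1.
    by rewrite /= incE1 // -fd -zE ?v1.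
  apply/orP/idP => [[]/imfsetP[[d' x] /= dx [dd ->]]|dz].
  + by move/esym/eqP: dd; rewrite double_neq_doubleS.
  + by rewrite fg -incE2 // ?(double_inj dd) //; case/inc_sub: dx.
  right; have : f z \in V2 by apply: inV2 dz; rewrite -gE2 in_imfset.
  rewrite -fE2 => /imfsetP[x /= xG]; rewrite -fg => /fI zE.
  apply/imfsetP; exists (d, x); last by rewrite /= -zE ?v2.
  by rewrite /= incE2 // -fg -zE ?v2.
- by move=> u z /=; case ux: (lab G1 u) => [x|] //= [<-]; rewrite fd; apply: labB1.
by move=> y /actB1[x lx xy]; exists x.*2; rewrite ?fd //= lx.
Qed.

Lemma build_realizes V E B : build V E B ->
  exists t f g, in_L t /\ realizes (graph_of t) V E B f g.
Proof.
elim=> {V E B} [|x V E B bu [t [f [g [[S tS] tR]]]] xH xV xB|x V E B bu [t [f [g [[S tS] tR]]]] xB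
  |e V E B bu [t [f [g [[S tS] tR]]]] eH eE eB
  |V1 V2 E1 E2 B b1 [t1 [f1 [g1 [[S1 tS1] tR1]]]] b2 [t2 [f2 [g2 [[S2 tS2] tR2]]]] V12 E12].
- exists Leaf, id, id; split; first by exists set0; apply: reaches_Leaf.
  by split=> //=; rewrite ?imfset0.
- exists (IntroVertex (c x) t); do 2!eexists; split; last exact: realizes_vertex bu tR xV xB.
  exists (c x |: S); apply: (reaches_IntroVertex (tS)).
  rewrite -(reaches_lab_set tS) inE; case E1: (lab _ _) => [z|//].
  by have [/xB] := realizes_lab tR E1; rewrite /= => h1 h2; rewrite h2 eqxx in h1.
- exists (ForgetVertex (c x) t), f, g; have [y xy yx] := realizes_act tR xB; split.
    exists (S :\ c x); apply: (reaches_ForgetVertex (tS)).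
    by rewrite -(reaches_lab_set tS) inE xy.
  have cI := build_inj bu.
  case: tR => [fI fE gI gE incE labB actB]; split=> //.
    move=> u z /=; case: eqP => // ux uz; have [zB zu] := labB _ _ uz; split=> //.
    by rewrite in_fsetD1 zB andbT; apply: contra_not_neq ux => <-.
  move=> z; rewrite in_fsetD1 => /andP[zx zB]; have [w zw wz] := actB z zB.
  exists w => //=; case: eqP => // czx; move: zx; rewrite (cI _ _ zB xB czx) ?eqxx //.
- have [a [b [ab eab]]] := edge_endpoints eH.
  have aB : a \in B by apply: eB; rewrite eab eqxx.
  have bB : b \in B by apply: eB; rewrite eab eqxx orbT.
  have cab : c a != c b by apply: contraNneq ab => /(build_inj bu aB bB) ->.
  have [x ax xa] := realizes_act tR aB; have [y bY yb] := realizes_act tR bB.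
  exists (IntroEdge cab t); do 2!eexists; split; last exact: realizes_edge bu tR eE aB bB eab.
  by exists S; apply: reaches_IntroEdge; rewrite // -(reaches_lab_set tS) inE ?ax ?bY.
have [f [g fgR]] := realizes_join b1 b2 V12 E12 tR1 tR2.
exists (Join t1 t2), f, g; split=> //; exists S1; apply: reaches_Join => //.
suff -> : S1 = S2 by [].
rewrite -(reaches_lab_set tS1) -(reaches_lab_set tS2); apply/setP => u; rewrite !inE.
case ux: (lab _ u) => [x|]; case uy: (lab _ u) => [y|] //=.
  by have [xB xu] := realizes_lab tR1 ux; have [z] := realizes_act tR2 xB; rewrite xu uy.
by have [yB yu] := realizes_lab tR2 uy; have [z] := realizes_act tR1 yB; rewrite yu ux.
Qed.
End Build.

(** * Assembling terms along a list of bags *)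

Section BuildTree.
Variables (k : nat) (H : graph) (c : nat -> 'I_k.+1).
Notation build := (build H c).

Lemma build_vertices A V E B : build V E B -> A `<=` verts H ->
  (forall x, x \in A -> x \notin V) -> {in A `|` B &, injective c} ->
  build (A `|` V) E (A `|` B).
Proof.
have [n] := ubnP #|` A|; elim: n A => // n IH A; rewrite ltnS => An bu AH AV cI.
case: (fset_0Vmem A) => [->|[x xA]]; first by rewrite !fset0U.
have AE : A = x |` (A `\ x) by rewrite fsetD1K.
have xN : x \notin A `\ x by rewrite !inE eqxx.
have A'A : A `\ x `<=` A := fsubD1set _ _.
have [BV _ _ _] := build_sub bu.
rewrite AE -!fsetUA; apply: build_vertex.
- apply: IH => //.
  + by move: An; rewrite (cardfsD1 x A) xA.
  + exact: fsubset_trans A'A AH.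
  + by move=> y /(fsubsetP A'A) /AV.
  by move=> y z yA zA; apply: cI; [move: yA|move: zA]; apply/fsubsetP/fsetSU.
- exact: (fsubsetP AH).
- by rewrite in_fsetU negb_or xN AV.
move=> y yAB; apply/eqP => cyx; have xB : x \notin B by apply: contra (AV _ xA) => /(fsubsetP BV).
have : y = x.
  by apply: cI; rewrite ?in_fsetU ?xA //; move: yAB; rewrite in_fsetU => /orP[/(fsubsetP A'A)|] ->; rewrite ?orbT.
by move=> yx; move: yAB; rewrite yx in_fsetU (negbTE xN) (negbTE xB).
Qed.

Lemma build_forgets A V E B : build V E B -> build V E (B `\` A).
Proof.
have [n] := ubnP #|` B|; elim: n B => // n IH B; rewrite ltnS => Bn bu.
case: (fset_0Vmem (B `&` A)) => [BA|[x]].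
  by have /fsetDidPl -> : [disjoint B & A]%fset by rewrite -fsetI_eq0 BA.
rewrite in_fsetI => /andP[xB xA].
have -> : B `\` A = (B `\ x) `\` A.
  by apply/fsetP => y; rewrite !inE; case: eqP => // ->; rewrite xA.
apply: IH; last exact: build_forget.
by move: Bn; rewrite (cardfsD1 x B) xB.
Qed.

Lemma build_edges F V E B : build V E B -> F `<=` edges H ->
  (forall e, e \in F -> e \notin E) ->
  (forall e v, e \in F -> (e, v) \in inc H -> v \in B) -> build V (F `|` E) B.
Proof.
have [n] := ubnP #|` F|; elim: n F => // n IH F; rewrite ltnS => Fn bu FH FE FB.
case: (fset_0Vmem F) => [->|[e eF]]; first by rewrite fset0U.
have F'F : F `\ e `<=` F := fsubD1set _ _.
rewrite -(fsetD1K eF) -fsetUA; apply: build_edge.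
- apply: IH => //.
  + by move: Fn; rewrite (cardfsD1 e F) eF.
  + exact: fsubset_trans F'F FH.
  + by move=> d /(fsubsetP F'F) /FE.
  by move=> d v /(fsubsetP F'F); apply: FB.
- exact: (fsubsetP FH).
- by rewrite in_fsetU negb_or FE // !inE eqxx.
by move=> v; apply: FB.
Qed.

(* The leaf bag that heads the list is merged into its parent. *)
Lemma build_rip (I : eqType) (bag : I -> {fset nat}) (s : seq I) (V E : I -> {fset nat}) :
  uniq s -> rip (map bag s) ->
  (forall i, i \in s -> bag i `<=` verts H /\ {in bag i &, injective c}) ->
  (forall i, i \in s -> build (V i) (E i) (bag i)) ->
  (forall i j, i \in s -> j \in s -> i != j -> V i `&` V j `<=` bag i) ->
  (forall i j e, i \in s -> j \in s -> i != j -> e \in E i -> e \notin E j) ->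
  exists W F B, build W F B /\ forall i, i \in s -> V i `<=` W /\ E i `<=` F.
Proof.
elim: s V E => [|l s IH] V E /=; first by move=> _ h; inversion h.
move=> /andP[ls s_uniq] h bagH bu VV EE.
have ls' i : i \in s -> i != l by move=> si; apply: contraNneq ls => <-.
have mem_s i : i \in s -> i \in l :: s by rewrite inE => ->; rewrite orbT.
have ll : l \in l :: s := mem_head _ _.
have [s0|[q [hs qs lq]]] : s = [::] \/ exists q, [/\ rip (map bag s), q \in s &
    forall i, i \in s -> bag i `&` bag l `<=` bag q].
  case: (rip_inv h) => [s0|[_ [hs /mapP[q qs ->] CB]]]; first by left; case: (s) s0.
  by right; exists q; split=> // i si; apply/CB/map_f.
  exists (V l), (E l), (bag l); split; first exact: bu.
  by move=> i; rewrite s0 inE => /eqP ->.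
(* [q] takes over the part of [l], in which the rest of [bag q] is introduced so that both sides of
   the join have active set [bag q]. *)
pose V' i := if i == q then V q `|` ((bag q `\` bag l) `|` V l) else V i.
pose E' i := if i == q then E q `|` E l else E i.
have ql := ls' _ qs; have qs' := mem_s _ qs.
have bagV i : i \in l :: s -> bag i `<=` V i by move=> /bu/build_sub[].
(* First forget [bag l] minus [bag q], then introduce [bag q] minus [bag l]. The latter is new to
   [V l], since vertices common to [V l] and [V q] lie in [bag l]. *)
have b_shift : build ((bag q `\` bag l) `|` V l) (E l) (bag q).
  have qE : bag q = (bag q `\` bag l) `|` (bag l `\` (bag l `\` bag q)).
    by apply/fsetP => x; rewrite !inE; case: (x \in bag q); case: (x \in bag l).
  rewrite [X in build _ _ X]qE; apply: build_vertices.
  - by apply: build_forgets; apply: bu.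
  - by apply: fsubset_trans (bagH _ qs').1; apply: fsubsetDl.
  - move=> x; rewrite in_fsetD => /andP[xl xq]; apply: contra xl => xV.
    apply: (fsubsetP (VV _ _ ll qs' _)); first by rewrite eq_sym.
    by rewrite in_fsetI xV (fsubsetP (bagV _ qs')).
  by rewrite -qE; apply: (bagH _ qs').2.
have [|||i si|i j si sj ij|i j e si sj ij|W [F [B [WFB WF]]]] := IH V' E'.
- done.
- done.
- by move=> i /mem_s; apply: bagH.
- rewrite /V' /E'; case: eqP => [->|_]; last by apply: bu; apply: mem_s.
  apply: build_join b_shift _ _; first exact: bu.
    apply/fsubsetP => x; rewrite in_fsetI !in_fsetU in_fsetD => /andP[xq /orP[/andP[]//|xl]].
    by apply: (fsubsetP (VV _ _ qs' ll ql)); rewrite in_fsetI xq.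
  by move=> e; apply: EE.
- have si' := mem_s _ si; have sj' := mem_s _ sj.
  apply/fsubsetP => x; rewrite in_fsetI /V' => /andP[].
  have VVP a b : a \in l :: s -> b \in l :: s -> a != b -> x \in V a -> x \in V b -> x \in bag a.
    by move=> sa sb ab xa xb; apply: (fsubsetP (VV _ _ sa sb ab)); rewrite in_fsetI xa.
  case: eqP => [iq|_]; case: eqP => [jq|_].
  + by rewrite iq jq eqxx in ij.
  + rewrite !in_fsetU in_fsetD iq => /orP[xq xj|/orP[/andP[]//|xl xj]].
      by apply: VVP xq xj => //; rewrite -iq.
    (* A vertex shared by [V l] and [V j] lies in both bags, hence in [bag q] by running
       intersection. *)
    apply: (fsubsetP (lq _ sj)); rewrite in_fsetI (VVP _ _ sj' ll (ls' _ sj) xj xl).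
    by rewrite (VVP _ _ ll sj' _ xl xj) // eq_sym ls'.
  + rewrite !in_fsetU in_fsetD => xi /orP[xq|/orP[/andP[_ /(fsubsetP (bagV _ qs')) xq]|xl]].
    * by apply: VVP xi xq; rewrite // -jq.
    * by apply: VVP xi xq; rewrite // -jq.
    by apply: VVP xi xl => //; apply: ls'.
  by move=> xi xj; apply: VVP xi xj.
- have si' := mem_s _ si; have sj' := mem_s _ sj.
  rewrite /E'; case: eqP => [iq|_]; case: eqP => [jq|_].
  + by rewrite iq jq eqxx in ij.
  + rewrite in_fsetU => /orP[]; apply: EE; rewrite // -?iq // eq_sym; exact: ls'.
  + by move=> ei; rewrite in_fsetU negb_or (EE i) // -?jq // (EE i) // ls'.
  exact: EE.
exists W, F, B; split=> // i; rewrite inE => /orP[/eqP ->|si].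
  have [] := WF _ qs; rewrite /V' /E' eqxx => VW EF; split.
    apply: fsubset_trans VW; rewrite fsetUA; exact: fsubsetUr.
  apply: fsubset_trans EF; exact: fsubsetUr.
have [] := WF _ si; rewrite /V' /E'; case: eqP => [-> VW EF|_ //].
by split; [apply: fsubset_trans VW|apply: fsubset_trans EF]; apply: fsubsetUl.
Qed.

End BuildTree.

(** Each node starts with its bag and the edges assigned to it, and [build_rip] merges these pieces.
    The result is all of [G], since every vertex lies in a bag and every edge has a home. *)
Lemma treewidth_term k G : treewidth_at_most k G ->
  exists2 t : term k, in_L t & isomorphic (graph_of t) G.
Proof.
case=> D Dk; have [s [s_uniq sT hs]] := tree_rip (td_tree D) (@td_conn _ D).
have bagk t : #|` @bag _ D t| <= k.+1.
  by move: Dk; rewrite /width -subn1 leq_subLR add1n => /bigmax_leqP; apply.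
have [_ /mapP[t _ ->]|c cI] := rip_coloring (k := k) hs; first exact: bagk.
(* An edge may fit into several bags; fixing one keeps the edge sets disjoint, so that no edge is
   introduced twice. *)
pose home e := [pick t | [fset v in verts G | (e, v) \in inc G] `<=` @bag _ D t].
have homeP e t : home e = Some t -> forall v, (e, v) \in inc G -> v \in bag t.
  rewrite /home; case: pickP => // t' sub [<-] v ev; apply: (fsubsetP sub).
  by rewrite !inE ev andbT; case/inc_sub: ev.
have home_ex e : e \in edges G -> exists t, home e = Some t.
  move=> /(td_edge D)[t tP]; rewrite /home; case: pickP => [t' _|/(_ t)/negP[]]; first by exists t'.
  by apply/fsubsetP => v; rewrite !inE => /andP[_ /tP].
pose E t := [fset e in edges G | home e == Some t].
have bagI (t : node D) : {in bag t &, injective c} by apply: cI (map_f _ (sT t)).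
have b0 (t : node D) : build G c (bag t) (E t) (bag t).
  rewrite -[X in build _ _ _ X]fsetU0; apply: build_edges.
  - rewrite -[bag t]fsetU0; apply: build_vertices; rewrite ?fsetU0 //; first exact: build_empty.
    exact: td_bag.
  - exact: fset_sub.
  - by move=> e _; rewrite in_fset0.
  by move=> e v; rewrite !inE => /andP[_ /eqP]; move/homeP; apply.
have [i si||i j si sj _|i j e si sj ij|W [F [B [bu WF]]]] :=
  @build_rip k G c _ (@bag _ D) s (@bag _ D) E s_uniq hs.
- by split; [apply: td_bag|apply: bagI].
- by move=> i _; apply: b0.
- exact: fsubsetIl.
- rewrite !inE => /andP[-> /eqP ->] /=; apply: contra ij => /eqP[->] //.
have [_ WG FG _] := build_sub bu.
have WE : W = verts G.
  apply/eqP; rewrite eqEfsubset WG; apply/fsubsetP => v /(td_vert D)[t vt].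
  exact: (fsubsetP (WF t (sT t)).1).
have FE : F = edges G.
  apply/eqP; rewrite eqEfsubset FG; apply/fsubsetP => e eG; have [t et] := home_ex e eG.
  by apply: (fsubsetP (WF t (sT t)).2); rewrite !inE eG et eqxx.
have [t [f [g [tL [fI fE gI gE incE _ _]]]]] := build_realizes bu.
by exists t => //; exists f, g; split; rewrite // ?fE ?gE.
Qed.

Theorem theorem2 (r : nat) :
  coherent (VC r) /\
  forall (k : nat) (G : graph),
    graph_property (VC r k) G <->
    treewidth_at_most k G /\
    exists2 X : {fset nat}, vertex_cover G X & (#|` X|%fset <= r)%N.
Proof.
split=> [|k G]; first exact: vc_coherent.
split=> [[t [[B tB] tA tG]]|[/treewidth_term[t [B tB] tG] [X Xc Xr]]].
  have [s hs _] := term_bag_list tB; have [s' hs'] := bag_list_isomorphic tG hs.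
  split; first exact: bag_list_treewidth hs'.
  have [X /(isomorphic_vertex_cover tG)[Y Yc YX] Xr] := (vc_acceptedP r tB).1 tA.
  by exists Y; rewrite ?YX.
exists t; split=> //; first by exists B.
apply/(vc_acceptedP r tB).
have [Y Yc YX] := isomorphic_vertex_cover (isomorphic_sym tG) Xc.
by exists Y; rewrite ?YX.
Qed.
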